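(* Let $R=\mathbb{Z}[i]$ be the ring of Gaussian integers. (a) For each odd $n \ge 5$ and any finite set $F\subseteq\mathbb{N}$ (with $\min F\ge 3$ in case $F\neq\emptyset$) which does not contain any divisors of $2$, $5$ or $10$, we have $Q_{U(\mathbb{Z}[i],F,n)} \ge \frac{10}{3}$. (b) Let $n \ge 6$ and let $F\subseteq\mathbb{N}$ be an arbitrary finite set such that $\min F \ge 3$ in case that $F \ne \emptyset$. Then $Q_{U(\mathbb{Z}[i],F,n)} \ge \frac{5}{2}$. (c) For any $n \ge 3$ we have $Q_{A(\mathbb{Z}[i],n)} \ge 4n-10$.
   Context: $\mathbb{Z}[i]=\{a+bi : a,b\in\mathbb{Z}\}$, with norm $N(a+bi)=a^2+b^2$. For a positive integer $m$, $\mathrm{rad}(m)$ is the largest square-free positive divisor of $m$. For $a=(a_1,\dots,a_n)\in R^n$ ($R=\mathbb{Z}[i]$) with all $a_j\neq 0$, the quality is $$q(a)=\frac{\log(\max(N(a_1),\dots,N(a_n)))}{\log(\mathrm{rad}(N(a_1\cdots a_n)))}.$$ For an infinite (countable) set $S=\{a^{(1)},a^{(2)},\dots\}$ of such $n$-tuples (enumerated without repetition), $Q_S=\limsup_{k\to\infty}q(a^{(k)})$ (possibly $+\infty$). The finitely many tuples consisting only of units, for which the denominator is $0$, are disregarded in the limsup. Let $n\ge 3$. $A(R,n)$ is the set of $a=(a_1,\dots,a_n)\in R^n$ with all $a_j\ne 0$ satisfying: (Z) $a_1+\dots+a_n=0$; (S1) there are no $b_1,\dots,b_n\in\{0,1\}$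 and indices $i,j$ with $b_i=0$, $b_j=1$ and $\sum_{k=1}^n b_ka_k=0$; (G1) the greatest common divisor of $a_1,\dots,a_n$ in $R$ is $1$ (up to units). For a finite set $F\subseteq\mathbb{N}$ with $\min F\ge 3$ if $F\neq\emptyset$, $U(R,F,n)$ is the set of $a=(a_1,\dots,a_n)\in R^n$ with all $a_j\neq 0$ satisfying: (Z) $a_1+\dots+a_n=0$; (S2) there are no $b_1,\dots,b_n\in\{-1,0,1\}$ and indices $i,j$ with $b_i=0$, $b_j=1$ and $\sum_{k=1}^n b_ka_k=0$; (G2) for all $i<j$, the greatest common divisor of $a_i$ and $a_j$ in $R$ is $1$ (up to units); (F) none of $a_1,\dots,a_n$ is a multiple in $R$ of any element of $F$. *)

(* Defs.v *)
From HB Require Import structures.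
From mathcomp Require Import all_boot all_order all_algebra.
From mathcomp Require Import all_classical all_reals all_analysis.
From mathcomp Require Import ring lra zify.

Set Implicit Arguments.
Unset Strict Implicit.
Unset Printing Implicit Defensive.

Import Order.TTheory GRing.Theory Num.Theory.

Local Open Scope classical_set_scope.
Local Open Scope ring_scope.

(* [Gaussint x y] is the Gaussian integer x + y i. *)
Record gaussint : Type := Gaussint { gre : int; gim : int }.

Definition gaussint_pair (x : gaussint) : int * int := (gre x, gim x).
Definition pair_gaussint (p : int * int) : gaussint := Gaussint p.1 p.2.
Lemma gaussint_pairK : cancel gaussint_pair pair_gaussint.
Proof. by case. Qed.

HB.instance Definition _ := Choice.copy gaussint (can_type gaussint_pairK).
HB.instance Definition _ := Countable.copy gaussint (can_type gaussint_pairK).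

Definition addg (x y : gaussint) := Gaussint (gre x + gre y) (gim x + gim y).
Definition oppg (x : gaussint) := Gaussint (- gre x) (- gim x).
Definition mulg (x y : gaussint) :=
  Gaussint (gre x * gre y - gim x * gim y) (gre x * gim y + gim x * gre y).

Lemma addgA : associative addg.
Proof. by move=> [a b] [c d] [e f]; rewrite /addg /= !addrA. Qed.
Lemma addgC : commutative addg.
Proof. by move=> [a b] [c d]; rewrite /addg /= (addrC a) (addrC b). Qed.
Lemma add0g : left_id (Gaussint 0 0) addg.
Proof. by move=> [a b]; rewrite /addg /= !add0r. Qed.
Lemma addNg : left_inverse (Gaussint 0 0) oppg addg.
Proof. by move=> [a b]; rewrite /addg /= !addNr. Qed.
HB.instance Definition _ := GRing.isZmodule.Build gaussint addgA addgC add0g addNg.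

Lemma mulgA : associative mulg.
Proof. by move=> [a b] [c d] [e f]; rewrite /mulg /=; congr Gaussint; ring. Qed.
Lemma mulgC : commutative mulg.
Proof. by move=> [a b] [c d]; rewrite /mulg /=; congr Gaussint; ring. Qed.
Lemma mul1g : left_id (Gaussint 1 0) mulg.
Proof. by move=> [a b]; rewrite /mulg /=; congr Gaussint; ring. Qed.
Lemma mulgDl : left_distributive mulg addg.
Proof. by move=> [a b] [c d] [e f]; rewrite /mulg /addg /=; congr Gaussint; ring. Qed.
Lemma oneg_neq0 : Gaussint 1 0 != 0 :> gaussint.
Proof. by []. Qed.
HB.instance Definition _ :=
  GRing.Zmodule_isComNzRing.Build gaussint mulgA mulgC mul1g mulgDl oneg_neq0.

Definition gnorm (x : gaussint) : nat := `|(gre x ^+ 2 + gim x ^+ 2)%R|%N.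

Lemma gnormE (x : gaussint) : (gnorm x)%:Z = gre x ^+ 2 + gim x ^+ 2.
Proof. by rewrite /gnorm gez0_abs // addr_ge0 ?sqr_ge0. Qed.

Lemma gnormM (x y : gaussint) : gnorm (x * y) = (gnorm x * gnorm y)%N.
Proof.
apply/eqP; rewrite -eqz_nat PoszM !gnormE; apply/eqP.
by case: x y => [a b] [c d] /=; ring.
Qed.

Definition gunit : pred gaussint := fun x => gnorm x == 1%N.
(* Only relevant on units, where the conjugate is the inverse. *)
Definition ginv (x : gaussint) : gaussint :=
  if gunit x then Gaussint (gre x) (- gim x) else x.

Lemma mulVg : {in gunit, left_inverse 1 ginv *%R}.
Proof.
move=> x; rewrite unfold_in /ginv /gunit => ux; rewrite ux.
move: ux; rewrite -eqz_nat gnormE => /eqP; case: x => [a b] /= h.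
by congr Gaussint; rewrite /= -?[RHS]h; ring.
Qed.
Lemma gunitPl (x y : gaussint) : y * x = 1 -> gunit x.
Proof.
by move/(congr1 gnorm); rewrite gnormM => /eqP; rewrite muln_eq1 => /andP[_].
Qed.
Lemma ginv_out : {in [predC gunit], ginv =1 id}.
Proof. by move=> x; rewrite inE /= /ginv -topredE /=; case: gunit. Qed.
HB.instance Definition _ :=
  GRing.ComNzRing_hasMulInverse.Build gaussint mulVg gunitPl ginv_out.

Definition gdvd (d x : gaussint) : Prop := exists c, x = c * d.

Definition is_gcd (s : seq gaussint) (g : gaussint) : Prop :=
  {in s, forall x, gdvd g x} /\ (forall d, {in s, forall x, gdvd d x} -> gdvd d g).

Definition squarefree (m : nat) : bool :=
  [forall k : 'I_m.+1, (k ^ 2 %| m)%N ==> (k == 1 :> nat)].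

Lemma squarefreeP (m : nat) :
  reflect (forall k, (k ^ 2 %| m)%N -> k = 1%N) (squarefree m).
Proof.
apply: (iffP forallP) => [h k km|h k]; last by apply/implyP => /h ->.
have [m0|m_gt0] := posnP m; first by have := h ord0; rewrite m0.
have lekm : (k < m.+1)%N.
  rewrite ltnS; apply: leq_trans (dvdn_leq m_gt0 km).
  by rewrite -mulnn; case: k {km} => // k; rewrite leq_pmulr.
by have /implyP/(_ km)/eqP := h (Ordinal lekm).
Qed.

Definition rad (m : nat) : nat := \max_(d <- divisors m | squarefree d) d.

Definition quality (R : realType) (n : nat) (a : n.-tuple gaussint) : R :=
  ln (\max_(j < n) gnorm (tnth a j))%:R / ln (rad (gnorm (\prod_(j < n) tnth a j)))%:R.

Definition unit_tuples (n : nat) : set (n.-tuple gaussint) :=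
  [set a | forall j, tnth a j \is a GRing.unit].
Arguments unit_tuples n : clear implicits.

(* Unit tuples are left out: their quality has denominator ln 1 = 0. *)
Definition enumerates (n : nat) (S : set (n.-tuple gaussint))
    (a : nat -> n.-tuple gaussint) : Prop :=
  set_bij [set: nat] (S `\` unit_tuples n) a.

Definition enumeration (n : nat) (S : set (n.-tuple gaussint)) : nat -> n.-tuple gaussint :=
  xget (fun=> nseq_tuple n 0) [set a | enumerates S a].

(* Q_S, meaningful for infinite S: an enumeration then exists
   ([enumeration_infinite]) and the value does not depend on it ([QE]). *)
Definition Q (R : realType) (n : nat) (S : set (n.-tuple gaussint)) : \bar R :=
  limn_esup (fun k => (quality R (enumeration S k))%:E).

Lemma unit_tuples_finite (n : nat) : finite_set (unit_tuples n).
Proof.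
pose L := [:: Gaussint 1 0; Gaussint (-1) 0; Gaussint 0 1; Gaussint 0 (-1)].
have unitL (x : gaussint) : x \is a GRing.unit -> x \in L.
  change (x \is a GRing.unit) with (gunit x).
  rewrite /gunit -eqz_nat gnormE !inE; case: x => [a b] /= /eqP h.
  have : (a == 1) && (b == 0) || (a == -1) && (b == 0) ||
         (a == 0) && (b == 1) || (a == 0) && (b == -1) by nia.
  by rewrite -!orbA => /or4P[] /andP[/eqP-> /eqP->]; rewrite eqxx ?orbT.
apply: (@sub_finite_set _ _
  (range (fun t : n.-tuple 'I_4 => map_tuple (fun i : 'I_4 => nth 0 L i) t))).
  move=> a ua; exists (map_tuple (fun x => inord (index x L)) a) => //.
  apply: eq_from_tnth => j; rewrite !tnth_map inordK ?nth_index ?unitL //.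
  by rewrite -[4%N]/(size L) index_mem unitL.
exact/finite_image/finite_finset.
Qed.

Lemma enumeration_infinite (n : nat) (S : set (n.-tuple gaussint)) :
  infinite_set S -> enumerates S (enumeration S).
Proof.
move=> Sinf; apply: (@xgetPex _ _ [set a | enumerates S a]).
have : ([set: nat] #= S `\` unit_tuples n)%card.
  rewrite card_eq_sym; apply: eq_card_nat => //.
  exact/infinite_setD/unit_tuples_finite.
pose pT : pointedType :=
  HB.pack (n.-tuple gaussint) (isPointed.Build (n.-tuple gaussint) (nseq_tuple n 0)).
by move/(@card_set_bijP _ pT) => [f fP]; exists f.
Qed.

Lemma limn_esup_inj_le (R : realType) (u : nat -> \bar R) (s : nat -> nat) :
  injective s -> (limn_esup (u \o s) <= limn_esup u)%E.
Proof.
move=> s_inj.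
have s_oo N : exists M, forall k, (M <= k)%N -> (N <= s k)%N.
  elim: N => [|N [M sM]]; first by exists 0%N.
  have [[k0 k0N]|noN] := pselect (exists k0, s k0 = N).
    exists (maxn M k0.+1) => k; rewrite geq_max => /andP[/sM + k0k].
    rewrite leq_eqVlt => /orP[/eqP Nk|//]; move: k0k.
    by rewrite (s_inj k k0) ?ltnn // k0N.
  exists M => k /sM; rewrite leq_eqVlt => /orP[/eqP Nk|//].
  by case: noN; exists k.
apply: le_ereal_inf_tmp => _ [B [N _ NB] <-].
have [M sM] := s_oo N.
apply: ge_ereal_inf; exists (ereal_sup ((u \o s) @` (s @^-1` B))).
  by exists (s @^-1` B) => //; exists M => // k /= /sM /NB.
by apply: ereal_sup_le => _ [k Bk <-]; exists (s k).
Qed.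

Lemma QE (R : realType) (n : nat) (S : set (n.-tuple gaussint)) a :
  enumerates S a -> Q R S = limn_esup (fun k => (quality R (a k))%:E).
Proof.
move=> aP; have eP : enumerates S (enumeration S).
  by apply: (@xgetPex _ _ [set a | enumerates S a]); exists a.
suff le b c : enumerates S b -> enumerates S c ->
    (limn_esup (fun k => (quality R (b k))%:E) <=
     limn_esup (fun k => (quality R (c k))%:E))%E.
  by apply/eqP; rewrite eq_le !le.
move=> [bS b_inj _] [_ _ c_surj].
have /choice[s sP] : forall k, exists l, c l = b k.
  by move=> k; have [l _ <-] := c_surj _ (bS k I); exists l.
have -> : (fun k => (quality R (b k))%:E) = (fun l => (quality R (c l))%:E) \o s.
  by apply/funext => k /=; rewrite sP.
apply: limn_esup_inj_le => k l skl.
by apply: b_inj; rewrite ?in_setT // -!sP skl.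
Qed.

Definition no_subsum (n : nat) (B : seq int) (a : n.-tuple gaussint) : Prop :=
  ~ exists b : 'I_n -> int,
      [/\ forall k, b k \in B, exists i, b i = 0, exists j, b j = 1 &
          \sum_(k < n) (b k)%:~R * tnth a k = 0].

Definition A (n : nat) : set (n.-tuple gaussint) :=
  [set a | [/\ forall j, tnth a j != 0,
               \sum_(j < n) tnth a j = 0,
               no_subsum [:: 0; 1] a &
               is_gcd a 1]].
Arguments A n : clear implicits.

Definition U (F : set nat) (n : nat) : set (n.-tuple gaussint) :=
  [set a | [/\ forall j, tnth a j != 0,
               \sum_(j < n) tnth a j = 0,
               no_subsum [:: -1; 0; 1] a,
               forall i j : 'I_n, (i < j)%N -> is_gcd [:: tnth a i; tnth a j] 1 &
               forall j f, F f -> ~ gdvd f%:R (tnth a j)]].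
Arguments U F n : clear implicits.

(* Main.v *)
Require Import Defs.
From mathcomp Require Import all_boot all_order all_algebra.
From mathcomp Require Import all_classical all_reals all_analysis.
From mathcomp Require Import ring zify.

(* All the tuples consist of rational integers, for which the norm squares
   absolute values but leaves radicals unchanged, so that qualities double
   compared with Z.

   (a) In (x + 1)^5 - (x - 1)^5 - 10 (x^2 + 1)^2 + 8 = 0 replace 8 by n - 3
   fixed pairwise coprime odd integers of sum 8 (possible as n is odd), and take
   x + 1 = m^k with m = 1 modulo everything relevant: the radical is O(x^3).

   (b) In (x + b)^5 - (x - b)^5 = (10 b - 1) x^4 + (x^2 + 10 b^3)^2 + 2 b^5 - 100 b^6
   split the constant 100 b^6 - 2 b^5 into n - 4 >= 2 pairwise coprime integers
   and take x = m^k with m = 1 modulo everything relevant: the radical is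
   O(x^4), and with b a multiple of all of F no term is a multiple of an
   element of F.

   (c) With x = 2^l, x^(2k+1) - 1 is a combination with positive integer
   coefficients of the k + 1 terms x^j (x - 1)^(2(k-j)+1), where n = k + 3: the
   radical is O(x), and positivity excludes vanishing subsums.

   In (a) and (b) a vanishing signed subsum is excluded by comparing the digits
   in base x, which reduces it to the constants, chosen lacunary. *)

Import Defs.
Import Order.TTheory GRing.Theory Num.Theory.
Import numFieldNormedType.Exports.

Local Open Scope classical_set_scope.
Local Open Scope ring_scope.

(** * Radicals and qualities *)

(** Write e = h gcd(e, d). A prime dividing h divides e, hence d, hence the gcd, so its square
    divides e. *)
Lemma squarefree_dvd (e d j : nat) : squarefree e -> (e %| d ^ j)%N -> (e %| d)%N.
Proof.
move=> /squarefreeP sqf_e edj.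
have /dvdnP[h eE] := dvdn_gcdl e d.
suff h1 : h = 1%N by rewrite eE h1 mul1n dvdn_gcdr.
apply/eqP/negP => /negP h_neq1.
pose p := pdiv h.
have p_pr : prime p.
  apply: pdiv_prime; rewrite ltn_neqAle eq_sym h_neq1 lt0n.
  by apply/negP => /eqP h0; have := sqf_e 0%N; rewrite eE h0 => /(_ isT).
have ph : (p %| h)%N := pdiv_dvd h.
have pe : (p %| e)%N by rewrite eE dvdn_mulr.
have pd : (p %| d)%N by move: (dvdn_trans pe edj); rewrite Euclid_dvdX // => /andP[].
have : (p ^ 2 %| e)%N by rewrite eE expnS expn1 dvdn_mul // dvdn_gcd pe.
by move/sqf_e => p1; rewrite p1 in p_pr.
Qed.

(** Radicals are bounded without factoring: [d] only has to contain every prime of [m], so each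
    power in a product may be replaced by its base. *)
Lemma rad_le (m d j : nat) : (0 < d)%N -> (m %| d ^ j)%N -> (rad m <= d)%N.
Proof.
move=> d_gt0 mdj; have m_gt0 : (0 < m)%N by apply: dvdn_gt0 mdj; rewrite expn_gt0 d_gt0.
apply/bigmax_leqP_seq => e; rewrite -dvdn_divisors // => em sqf_e.
by apply/dvdn_leq => //; apply: squarefree_dvd sqf_e (dvdn_trans em mdj).
Qed.

Lemma rad_gt1 (m : nat) : (1 < m)%N -> (1 < rad m)%N.
Proof.
move=> m_gt1; have p_pr := pdiv_prime m_gt1.
apply: leq_trans (prime_gt1 p_pr) _.
apply: (@leq_bigmax_seq _ (divisors m) squarefree (fun d => d)).
  by rewrite -dvdn_divisors ?pdiv_dvd // ltnW.
apply/squarefreeP => k kkp; apply/eqP/negPn/negP => k1.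
have kE : k = pdiv m.
  by apply/(prime_nt_dvdP p_pr k1); apply: dvdn_trans kkp; rewrite dvdn_exp.
move/(dvdn_leq (prime_gt0 p_pr)): kkp.
by rewrite kE leqNgt -{1}[pdiv m]expn1 ltn_exp2l ?prime_gt1.
Qed.

Lemma limn_esup_le (R : realType) (u v : nat -> \bar R) :
  (forall k, (u k <= v k)%E) -> (limn_esup u <= limn_esup v)%E.
Proof.
move=> uv; apply: le_ereal_inf_tmp => _ [B FB <-].
apply: ge_ereal_inf; exists (ereal_sup (u @` B)); first by exists B.
apply: ge_ereal_sup => _ [k Bk <-].
by apply: le_ereal_sup_tmp; exists (v k) => //; exists k.
Qed.

(** The quality of [a k] is at least p(k+1) ln m / (ln C + q(k+1) ln m), which tends to p/q, and the
    limsup along an injective subfamily is at most that of the whole enumeration. Infinitude of [S]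
    is also concluded, since [Q] has its meaning only then. *)
Lemma Q_ge (R : realType) (n : nat) (S : set (n.-tuple gaussint))
    (a : nat -> n.-tuple gaussint) (p q C m : nat) :
  (0 < p)%N -> (0 < q)%N -> (1 < m)%N -> injective a -> (forall k, S (a k)) ->
  (forall k j, tnth (a k) j != 0) ->
  (forall k, (m ^ (p * k.+1) <= \max_(j < n) gnorm (tnth (a k) j))%N) ->
  (forall k, (rad (gnorm (\prod_(j < n) tnth (a k) j)%R) <= C * m ^ (q * k.+1))%N) ->
  infinite_set S /\ ((p%:R / q%:R)%:E <= Q R S)%E.
Proof.
move=> p_gt0 q_gt0 m_gt1 a_inj aS a_neq0 max_ge rad_leC.
have Sinf : infinite_set S.
  apply: (@sub_infinite_set _ (range a)) => [_ [k _ <-]//|].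
  move=> /finite_range_cst_subsequence[x [B Binf aB]].
  apply: Binf; have [->|/set0P[k Bk]] := eqVneq B set0; first exact: finite_set0.
  apply: (@sub_finite_set _ _ [set k]) => [l Bl|]; last exact: finite_set1.
  by apply: a_inj; rewrite ((aB l).1 Bl) ((aB k).1 Bk).
have max_gt1 k : (1 < \max_(j < n) gnorm (tnth (a k) j))%N.
  by apply: leq_trans (max_ge k); rewrite -{1}(expn0 m) ltn_exp2l // muln_gt0 p_gt0.
have a_unit k : (S `\` unit_tuples n) (a k).
  split=> // /= a_u; have := max_gt1 k; rewrite ltnNge => /negP; apply.
  by apply/bigmax_leqP => j _; have := a_u j; rewrite -topredE /= => /eqP ->.
have norm_gt0 k j : (0 < gnorm (tnth (a k) j))%N.
  rewrite lt0n -eqz_nat gnormE; apply: contra (a_neq0 k j).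
  rewrite paddr_eq0 ?sqr_ge0 // !sqrf_eq0 => /andP[/eqP g1 /eqP g2].
  by apply/eqP; case: (tnth _ _) g1 g2 => r i /= -> ->.
have normE k : gnorm (\prod_(j < n) tnth (a k) j) = (\prod_(j < n) gnorm (tnth (a k) j))%N.
  by rewrite (big_morph gnorm gnormM (erefl : gnorm 1 = 1%N)).
have norm_gt1 k : (1 < gnorm (\prod_(j < n) tnth (a k) j)%R)%N.
  rewrite normE; apply: leq_trans (max_gt1 k) _; apply/bigmax_leqP => j _.
  by rewrite (bigD1 j) //= leq_pmulr // prodn_gt0.
split=> //; have [_ e_inj e_surj] := enumeration_infinite Sinf.
have /choice[s sP] k : exists l, enumeration S l = a k.
  by have [l _ <-] := e_surj _ (a_unit k); exists l.
have s_inj : injective s by move=> k l skl; apply: a_inj; rewrite -!sP skl.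
apply: le_trans (@limn_esup_inj_le _ _ s s_inj).
(* This is the lower bound with numerator and denominator divided by k + 1; [harmonic k] is
   1/(k+1). *)
pose u k : R := p%:R * ln m%:R / (ln C%:R * harmonic k + q%:R * ln m%:R).
have lnm_gt0 : 0 < ln m%:R :> R by rewrite ln_gt0 // ltr1n.
have C_gt0 : (0 < C)%N.
  rewrite lt0n; apply/eqP => C0; have := rad_leC 0%N.
  by rewrite C0 mul0n leqNgt ltnW // rad_gt1.
have u_cvg : (fun k => (u k)%:E) @ \oo --> (p%:R / q%:R)%:E.
  apply: cvg_EFin; first by apply: nearW.
  have -> : p%:R / q%:R = p%:R * ln m%:R / (ln C%:R * 0 + q%:R * ln m%:R) :> R.
    by rewrite mulr0 add0r -mulf_div divff ?gt_eqF // mulr1.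
  apply: cvgM; first exact: cvg_cst.
  apply: cvgV; first by rewrite mulr0 add0r mulf_neq0 ?pnatr_eq0 -?lt0n // gt_eqF.
  apply: cvgD; last exact: cvg_cst.
  by apply: cvgM; [exact: cvg_cst | exact: cvg_harmonic].
rewrite -(cvg_limn_einf_sup u_cvg).2; apply: limn_esup_le => k /=.
rewrite lee_fin sP /quality.
have ln_rad_gt0 : 0 < ln (rad (gnorm (\prod_(j < n) tnth (a k) j)))%:R :> R.
  by rewrite ln_gt0 // ltr1n rad_gt1.
have lnC_ge0 : 0 <= ln C%:R :> R by rewrite ln_ge0 // ler1n.
have den_gt0 : 0 < ln C%:R + (q * k.+1)%:R * ln m%:R :> R.
  by rewrite ltr_wpDl // mulr_gt0 // ltr0n muln_gt0 q_gt0.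
have -> : u k = (p * k.+1)%:R * ln m%:R / (ln C%:R + (q * k.+1)%:R * ln m%:R).
  rewrite /u /harmonic /=; move: den_gt0; rewrite !natrM => /lt0r_neq0.
  have : k.+1%:R != 0 :> R by rewrite pnatr_eq0.
  move: (k.+1%:R : R) (ln C%:R : R) (ln m%:R : R) => K c L K0 den0.
  by field; rewrite K0 den0.
apply: ler_pM.
- by rewrite mulr_ge0 ?ler0n // ltW.
- by rewrite invr_ge0 ltW.
- rewrite mulr_natl -lnXn ?ltr0n 1?ltnW // -natrX ler_ln ?posrE ?ltr0n.
  + by rewrite ler_nat.
  + by rewrite expn_gt0 ltnW.
  + exact: ltnW.
rewrite lef_pV2 ?posrE //.
rewrite mulr_natl -lnXn ?ltr0n 1?ltnW // -natrX -lnM ?posrE ?ltr0n ?expn_gt0 ?(ltnW m_gt1) //.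
rewrite -natrM ler_ln ?posrE ?ltr0n ?muln_gt0 ?C_gt0 ?expn_gt0 ?(ltnW m_gt1) //.
  by rewrite ler_nat.
by rewrite ltnW // rad_gt1.
Qed.

(** * Splitting an integer into coprime lacunary summands *)

Lemma dvdz_addr (d x y : int) : (d %| x)%Z -> (d %| x + y)%Z = (d %| y)%Z.
Proof.
move=> dx; apply/idP/idP => dy; last exact: rpredD.
by rewrite -[y](addKr x) rpredD ?rpredN.
Qed.

Lemma dvdz_addl (d x y : int) : (d %| y)%Z -> (d %| x + y)%Z = (d %| x)%Z.
Proof. by move=> dy; rewrite addrC dvdz_addr. Qed.

Lemma coprime_primes (a b : nat) :
  (forall p, prime p -> (p %| a)%N -> (p %| b)%N -> False) -> coprime a b.
Proof.
move=> no_p; apply/negPn/negP => /negP g_neq1.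
have [/eqP g0|g_gt0] := posnP (gcdn a b).
  move: g0; rewrite -leqn0 leqNgt gcdn_gt0 negb_or -!eqn0Ngt => /andP[/eqP a0 /eqP b0].
  by apply: (no_p 2%N); rewrite ?a0 ?b0.
have g_gt1 : (1 < gcdn a b)%N by rewrite ltn_neqAle g_gt0 eq_sym andbT; apply/negP.
apply: (no_p (pdiv (gcdn a b)) (pdiv_prime g_gt1)).
  by apply: dvdn_trans (pdiv_dvd _) (dvdn_gcdl _ _).
by apply: dvdn_trans (pdiv_dvd _) (dvdn_gcdr _ _).
Qed.

Lemma prime_dvdzM (p : nat) (x y : int) : prime p ->
  (p %| x * y)%Z -> (p %| x)%Z \/ (p %| y)%Z.
Proof. by move=> p_pr; rewrite !dvdzE abszM Euclid_dvdM // => /orP. Qed.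

(* [X = 2 T + V y] with [V] the part of [W] coprime to [T] and [y] coprime to [T]:
   a prime dividing [T] does not divide [V y], and one dividing [V] sees
   [X = 2 T] and [T - X = - T]. *)
Lemma split_step (T : int) (W L : nat) : odd W -> T != 0 ->
  exists X : int,
    [/\ (L < `|X|)%N, coprime `|X| W, coprime `|X| `|T| & coprime `|T - X| W] /\
    [/\ odd `|X|, ~~ (4 %| `|T - X|)%N & odd `|T - X| = ~~ odd `|T| ].
Proof.
move=> W_odd T_neq0; have W_gt0 : (0 < W)%N := odd_gt0 W_odd.
pose t : nat := `|T|%N; have t_gt0 : (0 < t)%N by rewrite absz_gt0.
pose V : nat := (W`_(\pi(t)^'))%N.
have VW : (V %| W)%N := dvdn_part _ _.
have V_odd : odd V := dvdn_odd VW W_odd.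
have T_or_V p : prime p -> (p %| W)%N -> (p %| t)%N || (p %| V)%N.
  move=> p_pr; rewrite -{1}(partnC \pi(t)%N W_gt0) Euclid_dvdM // => /orP[pT|->]; last first.
    by rewrite orbT.
  have /pnatP := part_pnat \pi(t)%N W.
  move=> /(_ (part_gt0 _ _) p p_pr pT).
  by rewrite mem_primes => /and3P[_ _ ->].
have T_nV p : prime p -> (p %| t)%N -> ~~ (p %| V)%N.
  move=> p_pr pT; apply/negP => pV; have /pnatP := part_pnat (\pi(t)^')%N W.
  move=> /(_ (part_gt0 _ _) p p_pr pV).
  by rewrite inE /= mem_primes p_pr t_gt0 pT.
(* The sign handles the prime 2: T - X will be -(T + V s) modulo 4, which is 2 modulo 4 if T is odd
   and V s = T modulo 4. If T is even, T - X is odd anyway. *)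
have [s [s1 sV]] : exists s : int, `|s| = 1 /\ (odd `|T| -> (4 %| V%:Z * s - T)%Z).
  exists (if (4 %| V%:Z - T)%Z then 1 else -1); split; first by case: ifP.
  by clear -V_odd; case: ifP => VT T_odd; lia.
(* The factor t makes y = 1 or -1 modulo T, hence coprime to T; the factor L + 3 makes X large. *)
pose N := (t * (L + 3))%N.
have N_ge : (t * L + 3 * t <= N)%N by rewrite /N mulnDr (mulnC 3%N).
pose y := s + 4 * N%:Z.
pose Z := V%:Z * y; pose Q := V%:Z * N%:Z.
have ZE : Z = V%:Z * s + 4 * Q by rewrite /Z /y /Q; ring.
have V_gt0 : (0 < V)%N := odd_gt0 V_odd.
have Q_ge : N%:Z <= Q by rewrite /Q ler_peMl.
have VN : 3 * V%:Z <= Q.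
  by rewrite /Q mulrC ler_pM2l // lez_nat; clear -N_ge t_gt0; lia.
have L_le : (L <= t * L)%N by rewrite leq_pmull.
have s_cases : s = 1 \/ s = -1 by clear -s1; lia.
have T_nZ p : prime p -> (p %| T)%Z -> ~~ (p %| Z)%Z.
  move=> p_pr pT; apply/negP => /(prime_dvdzM _ _ _ p_pr)[pV|py].
    by have /negP := T_nV p p_pr pT; apply.
  have pN : (p %| 4 * N%:Z)%Z by rewrite dvdz_mull // dvdzE /= dvdn_mulr.
  have : (p %| s)%Z by move: (rpredB py pN); rewrite /y addrK.
  by rewrite dvdzE; case: s_cases => -> /=; rewrite Euclid_dvd1.
have T_or_Z p : prime p -> (p %| W)%N -> (p %| T)%Z || (p %| Z)%Z.
  move=> p_pr /(T_or_V p p_pr)/orP[pT|pV]; first by rewrite dvdzE pT.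
  by rewrite orbC /Z dvdz_mulr // dvdzE.
have odd_X : odd `|2 * T + Z| by clear -s_cases ZE V_odd; case: s_cases ZE => ->; lia.
exists (2 * T + Z); split; split.
- clear -N_ge L_le t_gt0 s_cases ZE Q_ge VN; rewrite /t in N_ge L_le t_gt0.
  by case: s_cases ZE => ->; lia.
- apply: coprime_primes => p p_pr pX pW; have pX' : (p %| 2 * T + Z)%Z by [].
  have := T_or_Z p p_pr pW; have [pT _|pT /= pZ] := boolP (p %| T)%Z.
    by have /negP := T_nZ p p_pr pT; apply; move: pX'; rewrite (dvdz_addr _ _ _ (dvdz_mull 2 pT)).
  move: pX'; rewrite dvdz_addl // => /(prime_dvdzM _ _ _ p_pr)[p2|]; last by apply/negP.
  have := dvdn_odd pW W_odd; move: p2; rewrite dvdzE /= dvdn_prime2 // => /eqP->.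
  by [].
- apply: coprime_primes => p p_pr pX pT; have pX' : (p %| 2 * T + Z)%Z by [].
  have pT' : (p %| T)%Z by []; have := T_nZ p p_pr pT'; move: pX'.
  by rewrite (dvdz_addr _ _ _ (dvdz_mull 2 pT')) => -> .
- apply: coprime_primes => p p_pr pX pW.
  have : (p %| T - (2 * T + Z))%Z by [].
  have -> : T - (2 * T + Z) = - (T + Z) by ring.
  rewrite rpredN; have := T_or_Z p p_pr pW; have [pT _|pT /= pZ] := boolP (p %| T)%Z.
    by rewrite dvdz_addr // => pZ; have /negP := T_nZ p p_pr pT; apply.
  by rewrite dvdz_addl //; apply/negP.
- by [].
- by clear -s_cases ZE sV V_odd; case: s_cases ZE sV => ->; lia.
- by clear -s_cases ZE V_odd; case: s_cases ZE => ->; lia.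
Qed.

(** A common divisor of [x] and [y] divides [w]. It is applied to identities that eliminate a
    variable and leave a simple [w]. *)
Lemma coprimez_comb (x y u v w : int) :
  u * x + v * y = w -> coprimez x w -> coprimez x y.
Proof.
move=> <- /coprimezP[[p q] /= pq1]; apply/coprimezP; exists (p + q * u, q * v) => /=.
by rewrite -pq1; ring.
Qed.

Definition sign_seq (b : nat -> int) := forall i, b i \in [:: -1; 0; 1].

Lemma sign_seqP (b : nat -> int) (i : nat) : sign_seq b -> b i = -1 \/ b i = 0 \/ b i = 1.
Proof. by move/(_ i); rewrite !inE => /or3P[]/eqP->; [left | right; left | right; right]. Qed.

Lemma sum_nth_cons (b : nat -> int) (x : int) (s : seq int) :
  \sum_(i < (size s).+1) b i * (x :: s)`_i =
  b 0%N * x + \sum_(i < size s) b i.+1 * s`_i.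
Proof. by rewrite big_ord_recl. Qed.

(** The bound [B] instead of 0 serves twice: comparing digits only shows that the signed sum of the
    constants is a sign times a fixed number, and in the induction of [split_sum] the summands
    already chosen act as an error term. *)
Definition rigid (B : nat) (s : seq int) := forall b, sign_seq b ->
  `|\sum_(i < size s) b i * s`_i| <= B%:Z ->
  forall i, (i < size s)%N -> b i = b 0%N.

Lemma rigid_sum (B : nat) (s : seq int) (b : nat -> int) : rigid B s -> sign_seq b ->
  `|\sum_(i < size s) b i * s`_i| <= B%:Z ->
  \sum_(i < size s) b i * s`_i = b 0%N * \sum_(z <- s) z.
Proof.
move=> rig bs /(rig b bs) bE; rewrite (big_nth 0) big_mkord mulr_sumr.
by apply: eq_bigr => i _; rewrite bE.
Qed.

(** The sum is (u - v) X + v T, which for distinct [u] and [v] has size at least |X| - |T| > B. *)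
Lemma rigid_step (T X u v : int) (B : nat) : (`|T| + B < `|X|)%N ->
  u = -1 \/ u = 0 \/ u = 1 -> v = -1 \/ v = 0 \/ v = 1 ->
  `|u * X + v * (T - X)| <= B%:Z -> v = u.
Proof. by move=> ltX [->|[->|->]] [->|[->|->]]; lia. Qed.

(** Induction: [split_step] peels off X, and T - X is split with W |X| for W, which makes the later
    summands coprime to X, and with B + |X| for B, which absorbs the term of X in a signed sum. Each
    odd X flips the parity of the remainder, so the last summand is odd exactly when T and m have
    equal parity. *)
Lemma split_sum (m : nat) (T : int) (W B : nat) : odd W -> T != 0 ->
  exists c : seq int,
    [/\ size c = m.+2, \sum_(z <- c) z = T, pairwise coprimez c & rigid B c] /\
    [/\ {in c, forall z : int, coprime `|z| W},
        {in c, forall z : int, ~~ (4 %| `|z|)%N} &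
        odd `|T| = odd m -> {in c, forall z : int, odd `|z|}].
Proof.
have odd4 (z : int) : odd `|z| -> ~~ (4 %| `|z|)%N by lia.
elim: m T W B => [|m IH] T W B W_odd T_neq0;
  have [X [[LX XW XT TXW] [X_odd TX4 TX_odd]]] := split_step T W (`|T| + B) W_odd T_neq0.
  exists [:: X; T - X]; split; split=> //.
  - by rewrite !big_cons big_nil; ring.
  - by rewrite /= !andbT; apply: (@coprimez_comb _ _ 1 1 T) => //; ring.
  - move=> b bs; rewrite /= !big_ord_recl big_ord0 /= addr0 => le_B [|[|//]] // _.
    by apply: rigid_step LX _ _ le_B; apply: sign_seqP.
  - by move=> z; rewrite !inE => /orP[]/eqP->.
  - by move=> z; rewrite !inE => /orP[]/eqP-> //; apply: odd4.
  - by move=> T_even z; rewrite !inE => /orP[]/eqP-> //; rewrite TX_odd T_even.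
have TX_neq0 : T - X != 0 by apply: contraTneq TX4 => ->.
have WX_odd : odd (W * `|X|) by rewrite oddM W_odd.
have [c [[c_size c_sum c_pw c_rig] [c_W c_4 c_odd]]] :=
  IH (T - X) (W * `|X|)%N (B + `|X|)%N WX_odd TX_neq0.
exists (X :: c); split; split.
- by rewrite /= c_size.
- by rewrite big_cons c_sum; ring.
- rewrite /= c_pw andbT; apply/allP => z /c_W.
  by rewrite coprimezE coprimeMr => /andP[_]; rewrite coprime_sym.
- move=> b bs; rewrite sum_nth_cons => le_B.
  have bs' : sign_seq (fun i => b i.+1) by move=> i; apply: bs.
  have le_BX : `|\sum_(i < size c) b i.+1 * c`_i| <= (B + `|X|)%N%:Z.
    by move: (sign_seqP b 0%N bs) le_B => [->|[->|->]]; lia.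
  have tail_const := c_rig _ bs' le_BX.
  move: le_B; rewrite (rigid_sum _ _ _ c_rig bs' le_BX) c_sum => le_B.
  (* The tail has collapsed to [b 1] times T - X, so only two terms are left to compare. *)
  have b10 : b 1%N = b 0%N by apply: rigid_step LX _ _ le_B; apply: sign_seqP.
  by case=> // i i_lt; rewrite tail_const.
- move=> z; rewrite inE => /predU1P[->//|/c_W].
  by rewrite coprimeMr => /andP[].
- by move=> z; rewrite inE => /predU1P[->|/c_4//]; apply: odd4.
- move=> T_par z; rewrite inE => /predU1P[->//|]; apply: c_odd.
  by rewrite TX_odd T_par /= negbK.
Qed.

(** * Tuples of rational integers *)

Lemma gaussint_intr (z : int) : z%:~R = Gaussint z 0 :> gaussint.
Proof.
have natE n : n%:R = Gaussint n 0 :> gaussint.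
  by elim: n => // n IHn; rewrite mulrS IHn -addn1 PoszD addrC.
by case: z => n; rewrite ?NegzE ?mulrNz -pmulrn natE // -[LHS]/(oppg _).
Qed.

Lemma gnorm_intr (z : int) : gnorm z%:~R = (`|z| ^ 2)%N.
Proof. by rewrite /gnorm gaussint_intr /= expr0n addr0 abszX. Qed.

Lemma gaussint_intr_eq0 (z : int) : (z%:~R == 0 :> gaussint) = (z == 0).
Proof. by rewrite gaussint_intr; apply/eqP/eqP => [[]|->]. Qed.

Lemma gdvd_intr (f : nat) (z : int) : gdvd f%:R z%:~R -> (f %| z)%Z.
Proof.
move=> [c]; rewrite pmulrn !gaussint_intr => /(congr1 gre) /= ->.
by rewrite mulr0 subr0 dvdz_mull.
Qed.

Definition gtuple (n : nat) (t : n.-tuple int) : n.-tuple gaussint :=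
  [tuple (tnth t i)%:~R | i < n].

Lemma gtuple_inj (n : nat) : injective (@gtuple n).
Proof.
move=> s t st; apply: eq_from_tnth => i.
by have := congr1 (fun t => gre (tnth t i)) st; rewrite !tnth_mktuple !gaussint_intr.
Qed.

Lemma gtuple_neq0 (n : nat) (t : n.-tuple int) (i : 'I_n) :
  0 \notin t -> tnth (gtuple n t) i != 0.
Proof.
rewrite tnth_mktuple gaussint_intr_eq0; apply: contra => /eqP <-.
exact: mem_tnth.
Qed.

Lemma sum_gtuple (n : nat) (t : n.-tuple int) (b : 'I_n -> int) :
  \sum_(i < n) (b i)%:~R * tnth (gtuple n t) i = (\sum_(i < n) b i * t`_i)%:~R.
Proof.
rewrite rmorph_sum; apply: eq_bigr => i _ /=.
by rewrite tnth_mktuple rmorphM (tnth_nth 0).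
Qed.

Lemma gtuple_sum0 (n : nat) (t : n.-tuple int) :
  \sum_(z <- t) z = 0 -> \sum_(i < n) tnth (gtuple n t) i = 0.
Proof.
rewrite big_tuple => t0; apply: etrans (_ : (\sum_(i < n) tnth t i)%:~R = 0).
  by rewrite rmorph_sum; apply: eq_bigr => i _; rewrite tnth_mktuple.
by rewrite t0.
Qed.

Lemma no_subsum_gtuple (n : nat) (B : seq int) (t : n.-tuple int) : 0 \in B ->
  (forall b : nat -> int, (forall i, b i \in B) -> \sum_(i < size t) b i * t`_i = 0 ->
    forall i, (i < size t)%N -> b i = b 0%N) ->
  no_subsum B (gtuple n t).
Proof.
rewrite size_tuple => B0 t_rig [b [bB [i bi] [j bj]]].
(* The coefficients are extended by 0, which lies in [B], to all natural indices. *)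
pose b' k := if insub k is Some o then b o else 0.
have b'E (k : 'I_n) : b' k = b k by rewrite /b' valK.
have b'B k : b' k \in B by rewrite /b'; case: insub.
rewrite sum_gtuple => /eqP; rewrite gaussint_intr_eq0 => /eqP bt0.
have : b' i = b' j.
  rewrite !(t_rig b') ?ltn_ord // -[RHS]bt0;
  by apply: eq_bigr => k _; rewrite b'E.
by rewrite !b'E bi bj.
Qed.

(** Everything can be checked in the rational integers: a Bezout identity there remains one in the
    Gaussian integers, and divisibility by a natural number descends to real parts. *)
Lemma U_gtuple (F : set nat) (n : nat) (t : n.-tuple int) :
  0 \notin t -> \sum_(z <- t) z = 0 ->
  (forall b, sign_seq b -> \sum_(i < size t) b i * t`_i = 0 ->
    forall i, (i < size t)%N -> b i = b 0%N) ->
  pairwise coprimez t -> (forall z f, z \in t -> F f -> ~~ (f %| z)%Z) ->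
  U F n (gtuple n t).
Proof.
move=> t_neq0 t_sum t_rig t_pw t_F; split.
- by move=> i; apply: gtuple_neq0.
- exact: gtuple_sum0.
- exact: no_subsum_gtuple.
- move=> i j ij; split; first by move=> x _; exists x; rewrite mulr1.
  move=> d dvd_d.
  have /coprimezP[[u v] /= uv1] : coprimez (tnth t i) (tnth t j).
    by rewrite !(tnth_nth 0); have /(pairwiseP 0) := t_pw; apply; rewrite ?inE ?size_tuple.
  have [c1 c1E] := dvd_d (tnth (gtuple n t) i) (mem_head _ _).
  have [c2 c2E] := dvd_d (tnth (gtuple n t) j) (mem_last _ [:: _]).
  exists (u%:~R * c1 + v%:~R * c2).
  by rewrite mulrDl -!mulrA -c1E -c2E !tnth_mktuple -!rmorphM -rmorphD uv1.
- move=> j f Ff; rewrite tnth_mktuple => /gdvd_intr fz.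
  by have /negP := t_F _ _ (mem_tnth j t) Ff.
Qed.

(** The entry -1 is a unit and makes the gcd trivial. *)
Lemma A_gtuple (n : nat) (t : n.-tuple int) :
  0 \notin t -> \sum_(z <- t) z = 0 -> -1 \in t ->
  (forall b : nat -> int, (forall i, b i \in [:: 0; 1]) ->
    \sum_(i < size t) b i * t`_i = 0 ->
    forall i, (i < size t)%N -> b i = b 0%N) ->
  A n (gtuple n t).
Proof.
move=> t_neq0 t_sum /tnthP[i tiE] t_rig; split.
- by move=> j; apply: gtuple_neq0.
- exact: gtuple_sum0.
- exact: no_subsum_gtuple.
split; first by move=> x _; exists x; rewrite mulr1.
move=> d /(_ _ (mem_tnth i _)) [c]; rewrite tnth_mktuple -tiE => cE.
by exists (- c); rewrite mulNr -cE rmorphN1 opprK.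
Qed.

(** The norm of an integer is its square: the exponent [p] of the maximum doubles, while the same
    [d] still bounds the radical. *)
Lemma Q_ge_gtuple (R : realType) (n : nat) (S : set (n.-tuple gaussint))
    (t : nat -> n.-tuple int) (p q C m : nat) :
  (0 < p)%N -> (0 < q)%N -> (1 < m)%N -> injective t ->
  (forall k, S (gtuple n (t k))) -> (forall k, 0 \notin t k) ->
  (forall k, exists2 z, z \in t k & (m ^ (p * k.+1) <= `|z|)%N) ->
  (forall k, exists d e, [/\ (0 < d)%N, (d <= C * m ^ (q * k.+1))%N &
      (`|(\prod_(z <- t k) z)%R| %| d ^ e)%N]) ->
  infinite_set S /\ (((2 * p)%:R / q%:R)%:E <= Q R S)%E.
Proof.
move=> p_gt0 q_gt0 m_gt1 t_inj tS t_neq0 t_max t_rad.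
apply: (@Q_ge R n S (fun k => gtuple n (t k)) (2 * p) q C m) => //.
- by rewrite muln_gt0.
- by move=> k l /gtuple_inj/t_inj.
- by move=> k j; apply: gtuple_neq0.
- move=> k; have [z /tnthP[i ->] z_ge] := t_max k.
  apply: leq_trans (leq_bigmax (F := fun j => gnorm (tnth (gtuple n (t k)) j)) i).
  by rewrite tnth_mktuple gnorm_intr -mulnA mulnC expnM leq_exp2r.
- move=> k; have [d [e [d_gt0 d_le dvd_d]]] := t_rad k.
  apply: leq_trans d_le; apply: (@rad_le _ _ (e * 2)) => //.
  have -> : \prod_(j < n) tnth (gtuple n (t k)) j = (\prod_(z <- t k) z)%:~R.
    by rewrite big_tuple rmorph_prod; apply: eq_bigr => i _; rewrite tnth_mktuple.
  by rewrite gnorm_intr expnM dvdn_exp2r.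
Qed.

Lemma common_multiple (F : set nat) : finite_set F -> (forall f, F f -> (3 <= f)%N) ->
  exists2 M, (0 < M)%N & forall f, F f -> (f %| M)%N.
Proof.
move=> /finite_seqP[s ->] s_ge; exists (\max_(f <- s) f)`!; first exact: fact_gt0.
move=> f fs; apply: dvdn_fact; rewrite (leq_trans _ (s_ge f fs)) //=.
exact: leq_bigmax_seq.
Qed.

(** If [f] divided [z], its odd part would divide both [z] and the odd part of [M], hence be 1; then
    [f] would be a power of 2, at least 4, and 4 would divide [z]. *)
Lemma ndvdz_part (M f : nat) (z : int) : (0 < M)%N -> (f %| M)%N -> (3 <= f)%N ->
  coprime `|z| (M`_(2%N)^')%N -> ~~ (4 %| `|z|)%N -> ~~ (f %| z)%Z.
Proof.
move=> M_gt0 fM f_ge3 zM z4; apply/negP; rewrite dvdzE /= => fz.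
have f_gt0 : (0 < f)%N by apply: leq_trans f_ge3.
have f1 : (f`_(2%N)^' = 1)%N.
  apply/eqP; rewrite -dvdn1 -[X in (_ %| X)%N](eqP zM) dvdn_gcd.
  by rewrite (dvdn_trans (dvdn_part _ _) fz) (partn_dvd _ M_gt0 fM).
have fE : f = (2 ^ logn 2 f)%N by rewrite -{1}(partnC 2%N f_gt0) f1 muln1 p_part.
have l_ge2 : (2 <= logn 2 f)%N.
  by rewrite leqNgt; apply/negP => l_lt; move: f_ge3; rewrite fE; case: (logn 2 f) l_lt => [|[|]].
by move/negP: z4; apply; apply: dvdn_trans fz; rewrite fE (dvdn_exp2l 2 l_ge2).
Qed.

(** * Odd n *)

Lemma coprimez_congr (x w d : int) : (d %| x - w)%Z -> coprimez w d -> coprimez x d.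
Proof.
move=> /dvdzP[q xwE] wd; rewrite coprimez_sym.
apply: (@coprimez_comb _ _ (- q) 1 w); last by rewrite coprimez_sym.
by rewrite mulNr -xwE; ring.
Qed.

Lemma coprimez_ndvdz (f : nat) (z : int) : (3 <= f)%N -> coprimez z f -> ~~ (f %| z)%Z.
Proof.
move=> f_ge3 zf; apply/negP => fz; move: zf.
by rewrite coprimezE /coprime (gcdn_idPr fz) /=; case: f f_ge3 {fz} => [|[|]].
Qed.

(** A nonzero [q] would give |x q| >= x > |p|. Applied repeatedly to a Horner form, this reads off
    signed digits in base [x]. *)
Lemma digit_eq0 (p q x : int) : p + x * q = 0 -> `|p| < x -> p = 0 /\ q = 0.
Proof.
move=> pxq px; have q0 : q = 0.
  apply/eqP; rewrite -absz_eq0 -leqn0 leqNgt; apply/negP => q_gt0.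
  have : x * `|q| <= `|p|.
    by rewrite -(ger0_norm (ltW (le_lt_trans (normr_ge0 p) px))) -normrM; lia.
  by have := le_lt_trans (normr_ge0 p) px; nia.
by split=> //; rewrite q0 mulr0 addr0 in pxq.
Qed.

Lemma sum_sign_le (b : nat -> int) (s : seq int) : sign_seq b ->
  `|\sum_(i < size s) b i * s`_i| <= \sum_(z <- s) `|z|.
Proof.
move=> bs; apply: le_trans (ler_norm_sum _ _ _) _.
rewrite [leRHS](big_nth 0) big_mkord; apply: ler_sum => i _.
by have := sign_seqP b i bs; rewrite normrM => -[->|[->|->]];
  rewrite ?normrN ?normr1 ?normr0 ?mul1r ?mul0r.
Qed.

Definition tuple_odd (x : int) (c : seq int) : seq int :=
  [:: (x + 1) ^+ 5, - (x - 1) ^+ 5, - (10 * (x ^+ 2 + 1) ^+ 2) & c].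

Lemma tuple_odd_digits (x S H u v w : int) :
  u = -1 \/ u = 0 \/ u = 1 -> v = -1 \/ v = 0 \/ v = 1 -> w = -1 \/ w = 0 \/ w = 1 ->
  `|S| <= H -> 100 + H < x ->
  u * (x + 1) ^+ 5 - v * (x - 1) ^+ 5 - w * (10 * (x ^+ 2 + 1) ^+ 2) + S = 0 ->
  [/\ v = u, w = u & S = 8 * u].
Proof.
move=> su sv sw S_le x_large e.
(* In this Horner form in [x], the digits at x and x^2 give v = u and w = u, and then the constant
   digit gives S = 8 u. *)
have {}e : (u + v - 10 * w + S) + x * (5 * (u - v) + x * (10 * (u + v - 2 * w)
    + x * (10 * (u - v) + x * (5 * (u + v - 2 * w) + x * (u - v))))) = 0.
  by rewrite -[RHS]e; ring.
have [|p0 {}e] := digit_eq0 _ _ _ e; first by clear e; lia.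
have [|p1 {}e] := digit_eq0 _ _ _ e; first by clear e; lia.
have [|p2 _] := digit_eq0 _ _ _ e; first by clear e; lia.
by clear e; split; lia.
Qed.

Lemma tuple_odd_neq0 (x : int) (c : seq int) : 100 + \sum_(z <- c) `|z| < x ->
  {in c, forall z : int, odd `|z|} -> 0 \notin tuple_odd x c.
Proof.
move=> x_large c_odd; have x_gt : 100 < x.
  by apply: le_lt_trans x_large; rewrite lerDl; apply: sumr_ge0.
rewrite !inE !negb_or -!(eq_sym _ 0) ?oppr_eq0 ?mulf_eq0 ?expf_eq0 /=.
apply/and4P; split; [lia | lia | clear -x_gt; nia|].
by apply/negP => /c_odd.
Qed.

Section TupleOdd.
Variables (M : nat) (c : seq int) (x : int).
Hypotheses (M_gt0 : (0 < M)%N) (x_large : 100 + \sum_(z <- c) `|z| < x).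
Hypotheses (x10 : (10 %| x)%Z) (xM : (M %| x)%Z) (xc : {in c, forall z : int, (z %| x)%Z}).
Hypotheses (c_sum : \sum_(z <- c) z = 8) (c_pw : pairwise coprimez c) (c_rig : rigid 8 c).
Hypotheses (cM : {in c, forall z : int, coprime `|z| (125 * M`_(2%N)^')%N}).
Hypothesis (c_odd : {in c, forall z : int, odd `|z|}).

Lemma tuple_odd_sum : \sum_(z <- tuple_odd x c) z = 0.
Proof. by rewrite !big_cons c_sum; ring. Qed.

Lemma tuple_odd_rigid b : sign_seq b ->
  \sum_(i < size (tuple_odd x c)) b i * (tuple_odd x c)`_i = 0 ->
  forall i, (i < size (tuple_odd x c))%N -> b i = b 0%N.
Proof.
move=> bs; rewrite /tuple_odd; set t1 := (x + 1) ^+ 5; set t2 := - _; set t3 := - _.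
rewrite (sum_nth_cons b t1 [:: t2, t3 & c]) (sum_nth_cons (fun i => b i.+1) t2 (t3 :: c)).
rewrite (sum_nth_cons (fun i => b i.+2)) {}/t1 {}/t2 {}/t3.
have bs3 : sign_seq (fun i => b i.+3) by move=> i; apply: bs.
have := sum_sign_le _ c bs3; have := rigid_sum _ _ _ c_rig bs3; have := c_rig _ bs3.
rewrite c_sum => c_const S_const S_le e.
have e' : b 0%N * (x + 1) ^+ 5 - b 1%N * (x - 1) ^+ 5 - b 2%N * (10 * (x ^+ 2 + 1) ^+ 2) +
    \sum_(i < size c) b i.+3 * c`_i = 0 by rewrite -[RHS]e; ring.
have [b10 b20 SE] := tuple_odd_digits _ _ _ _ _ _ (sign_seqP b 0%N bs)
  (sign_seqP b 1%N bs) (sign_seqP b 2%N bs) S_le x_large e'.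
have S_le8 : `|\sum_(i < size c) b i.+3 * c`_i| <= 8.
  by rewrite SE; case: (sign_seqP b 0%N bs) => [->|[->|->]].
(* Rigidity makes the sum over [c] equal to 8 times [b 3], while the digits make it 8 times
   [b 0]. *)
have b30 : b 3%N = b 0%N by apply: (@mulIf _ 8) => //; rewrite -S_const // SE mulrC.
by case=> [|[|[|i]]] i_lt //; rewrite (c_const S_le8 i i_lt).
Qed.

(** Eliminating [x] between two of x + 1, x - 1 and x^2 + 1 leaves 2, to which all three are coprime
    as [x] is even. Modulo an element of [c], which divides [x], they are 1 or -1. *)
Lemma tuple_odd_coprime : pairwise coprimez (tuple_odd x c).
Proof.
have x2 : (2 %| x)%Z by apply: dvdz_trans x10.
have c1 d : coprimez 1 d by rewrite coprimezE coprime1n.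
have cN1 d : coprimez (-1) d by rewrite coprimezE coprime1n.
have congrD d : (d %| x)%Z -> coprimez (x + 1) d.
  by move=> dx; apply: coprimez_congr (c1 d); rewrite addrK.
have congrB d : (d %| x)%Z -> coprimez (x - 1) d.
  by move=> dx; apply: coprimez_congr (cN1 d); rewrite opprK subrK.
have congrS d : (d %| x)%Z -> coprimez (x ^+ 2 + 1) d.
  by move=> dx; apply: coprimez_congr (c1 d); rewrite addrK dvdz_exp.
rewrite /tuple_odd !pairwise_cons c_pw andbT /=.
apply/and3P; split; [apply/and3P; split|apply/andP; split|]; rewrite ?coprimezN.
- apply/coprimezXl/coprimezXr.
  by apply: (@coprimez_comb _ _ 1 (-1) 2); [ring | apply: congrD].
- apply: coprimezXl; rewrite coprimezMr congrD //=; apply: coprimezXr.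
  by apply: (@coprimez_comb _ _ (1 - x) 1 2); [ring | apply: congrD].
- by apply/allP => z zc; apply/coprimezXl/congrD/xc.
- rewrite coprimeNz; apply: coprimezXl; rewrite coprimezMr congrB //=; apply: coprimezXr.
  by apply: (@coprimez_comb _ _ (- 1 - x) 1 2); [ring | apply: congrB].
- by apply/allP => z zc; rewrite coprimeNz; apply/coprimezXl/congrB/xc.
apply/allP => z zc; rewrite coprimeNz coprimezMl coprimezXl ?congrS ?xc // andbT.
(* What remains is the coefficient 10 of the third entry: [z] is odd, and prime to 5 because of the
   factor 125 = 5^3. *)
rewrite coprimez_sym; change (coprime `|z| (2 * 5)%N); rewrite coprimeMr coprimen2 c_odd //=.
by have := cM z zc; rewrite -[125%N]/(5 ^ 3)%N coprimeMr coprime_pexpr // => /andP[].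
Qed.

(** As [f] divides [x], the bases of the powers are 1 or -1 modulo [f], so only the coefficient 10
    of the third entry could be divisible by [f]. *)
Lemma tuple_odd_ndvdz z f : z \in tuple_odd x c -> (3 <= f)%N -> (f %| M)%N ->
  ~~ (f %| 10)%N -> ~~ (f %| z)%Z.
Proof.
move=> z_in f_ge3 fM f10; have fx : (f %| x)%Z by apply: dvdz_trans xM.
have c1 : coprimez 1 f by rewrite coprimezE coprime1n.
move: z_in; rewrite !inE => /or4P[/eqP->|/eqP->|/eqP->|zc].
- apply: coprimez_ndvdz => //; apply: coprimezXl.
  by apply: coprimez_congr c1; rewrite addrK.
- apply: coprimez_ndvdz => //; rewrite coprimeNz; apply: coprimezXl.
  by apply: (@coprimez_congr _ (-1)); rewrite ?coprimeNz // opprK subrK.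
- rewrite rpredN Gauss_dvdzl //; rewrite coprimez_sym; apply: coprimezXl.
  by apply: coprimez_congr c1; rewrite addrK dvdz_exp.
apply: (@ndvdz_part M) => //.
  by have := cM z zc; rewrite coprimeMr => /andP[].
by have := c_odd z zc; clear; lia.
Qed.

End TupleOdd.

Lemma PoszX (m k : nat) : (m ^ k)%N%:Z = m%:Z ^+ k.
Proof. by elim: k => // k IHk; rewrite expnS PoszM IHk exprS. Qed.

Lemma prod_dvdn_seq (c : seq int) (z : int) : z \in c -> (`|z| %| \prod_(y <- c) `|y|)%N.
Proof. by move=> zc; rewrite (big_rem z) //= dvdn_mulr. Qed.

Lemma abszX_prod (c : seq int) : `|(\prod_(y <- c) y)%R|%N = (\prod_(y <- c) `|y|)%N.
Proof. by rewrite (big_morph absz abszM (erefl : `|1|%N = 1%N)). Qed.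

Lemma dvdz_sub1_exp (P k : nat) : (P %| (P.+1)%:Z ^+ k - 1)%Z.
Proof.
by rewrite subrX1 dvdz_mulr // -addn1 PoszD addrK.
Qed.

Lemma U_odd_quality (R : realType) (n : nat) (F : set nat) :
  odd n -> (5 <= n)%N -> finite_set F -> (forall f, F f -> (3 <= f)%N) ->
  (forall f, F f -> ~~ (f %| 10)%N) ->
  infinite_set (U F n) /\ (((2 * 5)%:R / 3%:R)%:E <= Q R (U F n))%E.
Proof.
move=> n_odd n_ge5 F_fin F_ge3 F10.
have [M M_gt0 FM] := common_multiple F F_fin F_ge3.
(* Three entries are polynomials in x, and the other n - 3 = m + 2 split 8. *)
pose m := (n - 5)%N; have nE : n = m.+2.+3 by rewrite /m; lia.
have W_odd : odd (125 * M`_(2%N)^')%N.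
  by rewrite oddM /= -[odd _]negbK -dvdn2 -p'natE // part_pnat.
have [c [[c_size c_sum c_pw c_rig] [c_W c_4 c_odd]]] :=
  split_sum m 8 _ 8 W_odd isT.
have {}c_odd : {in c, forall z : int, odd `|z|}.
  by apply: c_odd; move: n_odd; rewrite nE /=; case: (odd m).
pose N := (\prod_(z <- c) `|z|)%N; pose H := (\sum_(z <- c) `|z|)%N.
have N_gt0 : (0 < N)%N.
  by rewrite /N big_seq_cond prodn_cond_gt0 // => z; rewrite andbT => /c_odd/odd_gt0.
(* [P] collects all prescribed divisors of x = (P + 1)^(k+1) - 1; its factor 100 + H makes x large
   enough for the digit comparison. *)
pose P := (M * N * 10 * (100 + H))%N; pose m0 := P.+1.
pose x k := m0%:Z ^+ k.+1 - 1.
have xE k : x k + 1 = m0%:Z ^+ k.+1 by rewrite /x subrK.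
have x_ge k : P%:Z <= x k.
  by rewrite /x lerBrDr addrC -intS ler_eXnr // lez_nat.
have HE : \sum_(z <- c) `|z| = H%:Z.
  by rewrite /H (big_morph Posz PoszD (erefl _ : Posz 0 = 0)); apply: eq_bigr.
have x_large k : 100 + \sum_(z <- c) `|z| < x k.
  apply: lt_le_trans (x_ge k); rewrite HE -PoszD ltz_nat /P.
  have : (0 < M * N)%N by rewrite muln_gt0 M_gt0.
  by move: (M * N)%N => K K_gt0; clear -K_gt0; nia.
have xP k d : (d %| P)%N -> (d %| x k)%Z.
  by move=> dP; apply: dvdz_trans (dvdz_sub1_exp P k.+1).
have x10 k : (10 %| x k)%Z by apply: (xP k 10%N); rewrite /P dvdn_mulr // dvdn_mull.
have xM k : (M %| x k)%Z by apply: (xP k M); rewrite /P -!mulnA dvdn_mulr.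
have xc k : {in c, forall z : int, (z %| x k)%Z}.
  move=> z zc; rewrite dvdzE; apply: dvdn_trans (_ : N %| _)%N.
    exact: prod_dvdn_seq.
  by apply: (xP k N); rewrite /P -!mulnA mulnCA dvdn_mulr.
have t_size k : size (tuple_odd (x k) c) == n by rewrite /= c_size -nE.
have t_neq0 k : 0 \notin Tuple (t_size k) by apply: tuple_odd_neq0.
have m0_gt1 : (1 < m0)%N by rewrite ltnS !muln_gt0 M_gt0 N_gt0.
rewrite mulnC.
apply: (@Q_ge_gtuple R n (U F n) (fun k => Tuple (t_size k)) 5 3 (m0 * 10 * N) m0) => //.
- move=> k l /(congr1 (fun t => head 0 (tval t))) /=; rewrite !xE -!exprM.
  have m0_neq1 : m0%:Z != 1 by rewrite eqz_nat gtn_eqF.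
  by move/(ieexprIn (isT : 0 < m0%:Z) m0_neq1)/eqP; rewrite eqn_pmul2r // => /eqP[].
- move=> k; apply: U_gtuple.
  + exact: t_neq0.
  + exact: tuple_odd_sum.
  + by apply: tuple_odd_rigid.
  + by apply: (@tuple_odd_coprime M).
  + move=> z f zt Ff; apply: (@tuple_odd_ndvdz M c (x k)) => //; first exact: F_ge3.
      exact: FM.
    exact: F10.
- move=> k; exists ((x k + 1) ^+ 5); first exact: mem_head.
  by rewrite xE !abszX mulnC expnM.
move=> k; pose y := (m0 ^ k.+1)%N; have yE : y%:Z = x k + 1 by rewrite xE PoszX.
have x_gt : 100 < x k by apply: le_lt_trans (x_large k); rewrite HE lerDl.
pose a := `|(x k - 1)%R|%N; have aE : a%:Z = x k - 1 by clear -x_gt; rewrite /a; lia.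
pose d := `|(x k ^+ 2 + 1)%R|%N.
have dE : d%:Z = x k ^+ 2 + 1 by rewrite /d gez0_abs // addr_ge0 ?sqr_ge0.
(* Here [m0] stands for the power (x + 1)^5, and a d is at most y^3 with y = x + 1; the exponent is
   that of [m0] in its power. *)
exists (m0 * 10 * N * (a * d))%N, (5 * k.+1)%N; split.
- rewrite !muln_gt0 N_gt0 /= -!ltz_nat aE dE; clear -x_gt.
  by apply/andP; split; [lia | nia].
- rewrite leq_mul2l [(3 * _)%N]mulnC expnM -/y; apply/orP; right.
  by rewrite -lez_nat PoszM PoszX aE dE yE; clear -x_gt; nia.
have -> : (m0 * 10 * N * (a * d) = m0 * (a * (10 * d * N)))%N by ring.
rewrite !big_cons abszM abszX abszM abszN abszX abszM abszN (abszM 10) (abszX 2) abszX_prod.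
rewrite xE abszX -expnM.
rewrite [(k.+1 * 5)%N]mulnC -/a -/d -/N !expnMn.
rewrite !dvdn_mul //; [by apply: dvdn_exp2l; rewrite leq_pmulr | exact: dvdn_exp
  | | exact: dvdn_exp].
by apply: dvdn_exp2l; rewrite (leq_trans _ (leq_pmulr _ _)).
Qed.

(** * Arbitrary n >= 6 *)

Definition tuple_any (b x : int) (c : seq int) : seq int :=
  [:: - ((10 * b - 1) * x ^+ 4), (x + b) ^+ 5, - (x - b) ^+ 5,
      - (x ^+ 2 + 10 * b ^+ 3) ^+ 2 & c].

Lemma tuple_any_digits (b x S H u v w z : int) :
  u = -1 \/ u = 0 \/ u = 1 -> v = -1 \/ v = 0 \/ v = 1 ->
  w = -1 \/ w = 0 \/ w = 1 -> z = -1 \/ z = 0 \/ z = 1 ->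
  `|S| <= H -> 0 < b -> 1000 * b ^+ 6 + H < x ->
  - (u * ((10 * b - 1) * x ^+ 4)) + v * (x + b) ^+ 5 - w * (x - b) ^+ 5
    - z * (x ^+ 2 + 10 * b ^+ 3) ^+ 2 + S = 0 ->
  [/\ v = u, w = u, z = u & S = (100 * b ^+ 6 - 2 * b ^+ 5) * u].
Proof.
move=> su sv sw sz S_le b_gt0 x_large e.
(* In the Horner form in [x], the digit at x gives w = v, the one at x^2 gives z = v, and the one at
   x^4 becomes (10 b - 1)(v - u). Each has size below 1000 b^6 + H. *)
have {}e : (b ^+ 5 * (v + w) - 100 * b ^+ 6 * z + S) + x * (b ^+ 4 * (5 * (v - w)) +
    x * (b ^+ 3 * (10 * (v + w - 2 * z)) + x * (b ^+ 2 * (10 * (v - w)) +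
    x * ((5 * b * (v + w) - (10 * b - 1) * u - z) + x * (v - w))))) = 0.
  by rewrite -[RHS]e; ring.
have b_ge1 : 1 <= b by lia.
have le6 i : (i <= 6)%N -> 1 <= b ^+ i <= b ^+ 6.
  by move=> i6; rewrite exprn_ege1 // ler_weXn2l.
have /andP[l1 h1] := le6 1%N isT; have /andP[l2 h2] := le6 2%N isT.
have /andP[l3 h3] := le6 3%N isT; have /andP[l4 h4] := le6 4%N isT.
have /andP[l5 h5] := le6 5%N isT.
rewrite expr1 in l1 h1.
(* The powers of [b] become variables between 1 and b^6, so that after enumeration of the signs the
   goals are linear. *)
move: (b ^+ 6) (b ^+ 5) (b ^+ 4) (b ^+ 3) (b ^+ 2) l1 h1 l2 h2 l3 h3 l4 h4 l5 h5 x_large e.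
move=> b6 b5 b4 b3 b2 l1 h1 l2 h2 l3 h3 l4 h4 l5 h5 x_large e {le6}.
have [|p0 {}e] := digit_eq0 _ _ _ e.
  by clear e; move: sv sw sz => [->|[->|->]] [->|[->|->]] [->|[->|->]]; lia.
have [|p1 {}e] := digit_eq0 _ _ _ e.
  by clear e p0; move: sv sw => [->|[->|->]] [->|[->|->]]; lia.
have wv : w = v by clear e p0; move: sv sw p1 => [->|[->|->]] [->|[->|->]]; lia.
subst w; have [|p2 {}e] := digit_eq0 _ _ _ e.
  by clear e p0 p1; move: sv sz => [->|[->|->]] [->|[->|->]]; lia.
have zv : z = v by clear e p0 p1; move: sv sz p2 => [->|[->|->]] [->|[->|->]]; lia.
subst z; have [|_ {}e] := digit_eq0 _ _ _ e; first by lia.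
have [|p4 _] := digit_eq0 _ _ _ e.
  by clear e p0 p1 p2; move: sv su => [->|[->|->]] [->|[->|->]]; lia.
have uv : u = v by clear e p0 p1 p2; move: sv su p4 => [->|[->|->]] [->|[->|->]]; lia.
by subst u; split=> //; clear -p0 sv; move: sv p0 => [->|[->|->]]; lia.
Qed.

Lemma tuple_any_const_neq0 (b : int) : 0 < b -> 100 * b ^+ 6 - 2 * b ^+ 5 != 0.
Proof.
move=> b_gt0; have -> : 100 * b ^+ 6 - 2 * b ^+ 5 = 2 * b ^+ 5 * (50 * b - 1) by ring.
by rewrite !mulf_neq0 ?expf_neq0 ?(gt_eqF b_gt0) //; lia.
Qed.

Lemma tuple_any_neq0 (b x : int) (c : seq int) : 0 < b ->
  1000 * b ^+ 6 + \sum_(z <- c) `|z| < x ->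
  {in c, forall z : int, ~~ (4 %| `|z|)%N} -> 0 \notin tuple_any b x c.
Proof.
move=> b_gt0 x_large c4.
have b6_ge : b <= b ^+ 6 by rewrite ler_eXnr //; lia.
have x_gt : 100 * b < x.
  apply: le_lt_trans x_large; rewrite -[leLHS]addr0; apply: lerD; first by lia.
  exact: sumr_ge0.
rewrite !inE !negb_or -!(eq_sym _ 0) ?oppr_eq0 ?mulf_eq0 ?expf_eq0 /= !negb_or.
have b3_gt0 : 0 < b ^+ 3 by rewrite exprn_gt0.
apply/and5P; split; [apply/andP; split; lia | lia | lia | |].
  by rewrite andbb; apply: lt0r_neq0; rewrite addr_gt0 ?exprn_gt0 ?mulr_gt0 //; lia.
by apply/negP => /c4.
Qed.

Section TupleAny.
Variables (M : nat) (b x : int) (c : seq int).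
Hypotheses (M_gt0 : (0 < M)%N) (b_gt0 : 0 < b).
Hypothesis x_large : 1000 * b ^+ 6 + \sum_(z <- c) `|z| < x.
Hypotheses (bM : (M %| b)%Z) (b10 : (10 %| b)%Z) (b3 : (3 %| b)%Z).
(* 3, 11 and 101 are the possible common prime factors, modulo [x = 1], of the
   first four terms and of [1 + 10 b], which divides a resultant. *)
Hypotheses (b11 : (11 %| b)%Z) (b101 : (101 %| b)%Z).
Hypotheses (xb : (b %| x - 1)%Z) (xp : (10 * b + 1 %| x - 1)%Z) (xm : (10 * b - 1 %| x - 1)%Z).
Hypothesis xc : {in c, forall z : int, (z %| x - 1)%Z}.
Hypothesis c_sum : \sum_(z <- c) z = 100 * b ^+ 6 - 2 * b ^+ 5.
Hypotheses (c_pw : pairwise coprimez c) (c_rig : rigid `|(100 * b ^+ 6 - 2 * b ^+ 5)%R| c).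
Hypothesis cb : {in c, forall z : int, [&& coprimez (1 + b) z, coprimez (1 - b) z,
  coprimez (10 * b - 1) z & coprimez (1 + 10 * b ^+ 3) z]}.
Hypothesis c4 : {in c, forall z : int, ~~ (4 %| `|z|)%N}.
Hypothesis cM : {in c, forall z : int, coprime `|z| (M`_(2%N)^')%N}.

Lemma tuple_any_sum : \sum_(z <- tuple_any b x c) z = 0.
Proof. by rewrite !big_cons c_sum; ring. Qed.

Lemma tuple_any_rigid s : sign_seq s ->
  \sum_(i < size (tuple_any b x c)) s i * (tuple_any b x c)`_i = 0 ->
  forall i, (i < size (tuple_any b x c))%N -> s i = s 0%N.
Proof.
move=> ss; rewrite /tuple_any.
set t1 := - _; set t2 := (x + b) ^+ 5; set t3 := - _; set t4 := - _.
rewrite (sum_nth_cons s t1 [:: t2, t3, t4 & c]) (sum_nth_cons (fun i => s i.+1) t2 [:: t3, t4 & c]).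
rewrite (sum_nth_cons (fun i => s i.+2) t3 (t4 :: c)) (sum_nth_cons (fun i => s i.+3)).
rewrite {}/t1 {}/t2 {}/t3 {}/t4.
have ss4 : sign_seq (fun i => s i.+4) by move=> i; apply: ss.
have := sum_sign_le _ c ss4; have := rigid_sum _ _ _ c_rig ss4; have := c_rig _ ss4.
rewrite c_sum => c_const S_const S_le e.
have e' : - (s 0%N * ((10 * b - 1) * x ^+ 4)) + s 1%N * (x + b) ^+ 5 - s 2%N * (x - b) ^+ 5
    - s 3%N * (x ^+ 2 + 10 * b ^+ 3) ^+ 2 + \sum_(i < size c) s i.+4 * c`_i = 0.
  by rewrite -[RHS]e; ring.
have [s10 s20 s30 SE] := tuple_any_digits _ _ _ _ _ _ _ _ (sign_seqP s 0%N ss)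
  (sign_seqP s 1%N ss) (sign_seqP s 2%N ss) (sign_seqP s 3%N ss) S_le b_gt0 x_large e'.
have K_neq0 := tuple_any_const_neq0 _ b_gt0.
have S_leK : `|\sum_(i < size c) s i.+4 * c`_i| <= `|(100 * b ^+ 6 - 2 * b ^+ 5)%R|%N%:Z.
  by rewrite SE normrM abszE; case: (sign_seqP s 0%N ss) => [->|[->|->]];
    rewrite ?normrN ?normr1 ?normr0 ?mulr1 ?mulr0.
have s40 : s 4%N = s 0%N by apply: (mulIf K_neq0); rewrite -S_const // SE mulrC.
by case=> [|[|[|[|i]]]] i_lt //; rewrite (c_const S_leK i i_lt).
Qed.

Let c1 d : coprimez 1 d. Proof. by rewrite coprimezE coprime1n. Qed.
Let cN1 d : coprimez (-1) d. Proof. by rewrite coprimezE coprime1n. Qed.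

(** Eliminating [x] between two entries leaves powers of [b], 2 b, 10 b^3 or b^2 (10 b + 1), the
    last from x^2 + 10 b^3 - (x - b)(x + b). Modulo these, 10 b - 1 and the elements of [c], one has
    x = 1, so it remains to compare 1 + b, 1 - b, 10 b - 1, 1 + 10 b^3 and 10 b + 1. *)
Lemma tuple_any_coprime : pairwise coprimez (tuple_any b x c).
Proof.
have b2 : (2 %| b)%Z by apply: dvdz_trans b10.
have am d : (d %| b)%Z -> coprimez (10 * b - 1) d.
  by move=> db; apply: coprimez_congr (cN1 d); rewrite opprK subrK dvdz_mull.
have pm d : (d %| b)%Z -> coprimez (1 + b) d.
  by move=> db; apply: coprimez_congr (c1 d); rewrite addrC addKr.
have mm d : (d %| b)%Z -> coprimez (1 - b) d.
  by move=> db; apply: coprimez_congr (c1 d); rewrite addrC addKr rpredN.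
(* Eliminating [b] leaves 11, 9 or 101, whose prime factors divide [b], whereas the forms are 1 or
   -1 modulo [b]. *)
have a_pb : coprimez (10 * b - 1) (1 + b).
  by apply: (@coprimez_comb _ _ (-1) 10 11); [ring | apply: am].
have a_mb : coprimez (10 * b - 1) (1 - b).
  by apply: (@coprimez_comb _ _ 1 10 (3 ^+ 2)); [ring | apply/coprimezXr/am].
have a_b3 : coprimez (10 * b - 1) (1 + 10 * b ^+ 3).
  by apply: (@coprimez_comb _ _ (- (100 * b ^+ 2 + 10 * b + 1)) 100 101); [ring | apply: am].
have p_pb : coprimez (1 + b) (10 * b + 1).
  by apply: (@coprimez_comb _ _ 10 (-1) (3 ^+ 2)); [ring | apply/coprimezXr/pm].
have p_mb : coprimez (1 - b) (10 * b + 1).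
  by apply: (@coprimez_comb _ _ 10 1 11); [ring | apply: mm].
have xD d : (d %| x - 1)%Z -> coprimez x d by move=> dx; apply: coprimez_congr (c1 d).
have xpD d : (d %| x - 1)%Z -> coprimez (1 + b) d -> coprimez (x + b) d.
  move=> dx; apply: coprimez_congr.
  by have -> : x + b - (1 + b) = x - 1 by ring.
have xmD d : (d %| x - 1)%Z -> coprimez (1 - b) d -> coprimez (x - b) d.
  move=> dx; apply: coprimez_congr.
  by have -> : x - b - (1 - b) = x - 1 by ring.
have xsD d : (d %| x - 1)%Z -> coprimez (1 + 10 * b ^+ 3) d -> coprimez (x ^+ 2 + 10 * b ^+ 3) d.
  move=> dx; apply: coprimez_congr.
  have -> : x ^+ 2 + 10 * b ^+ 3 - (1 + 10 * b ^+ 3) = (x - 1) * (x + 1) by ring.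
  by rewrite dvdz_mulr.
have x10 : (10 %| x - 1)%Z by apply: dvdz_trans xb.
rewrite /tuple_any !pairwise_cons c_pw andbT /= !coprimeNz !coprimezN.
have p5 (y z : int) : coprimez y z -> coprimez (y ^+ 5) z by apply: coprimezXl.
have p2 (y z : int) : coprimez y z -> coprimez y (z ^+ 2) by apply: coprimezXr.
have pp5 (y z : int) : coprimez y z -> coprimez y (z ^+ 5) by apply: coprimezXr.
have ax (z : int) : coprimez (10 * b - 1) z -> coprimez x z ->
    coprimez ((10 * b - 1) * x ^+ 4) z.
  by move=> az xz; rewrite coprimezMl az coprimezXl.
apply/and4P; split; [apply/and4P; split|apply/and3P; split|apply/andP; split|].
- apply/ax; apply/pp5; first by rewrite coprimez_sym xpD // coprimez_sym.
  by apply: (@coprimez_comb _ _ (-1) 1 b); [ring | apply: xD].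
- apply/ax; apply/pp5; first by rewrite coprimez_sym xmD // coprimez_sym.
  by apply: (@coprimez_comb _ _ 1 (-1) b); [ring | apply: xD].
- apply/ax; apply/p2; first by rewrite coprimez_sym xsD // coprimez_sym.
  apply: (@coprimez_comb _ _ (- x) 1 (10 * b ^+ 3)); first by ring.
  by rewrite coprimezMr xD //=; apply/coprimezXr/xD.
- apply/allP => z zc; rewrite coprimeNz; apply: ax; last exact/xD/xc.
  by have /and4P[] := cb z zc.
- apply/p5/pp5; apply: (@coprimez_comb _ _ 1 (-1) (2 * b)); first by ring.
  by rewrite coprimezMr !xpD ?pm // (dvdz_trans b2).
- apply/p5/p2; apply: (@coprimez_comb _ _ (b - x) 1 (b ^+ 2 * (10 * b + 1))); first by ring.
  rewrite coprimezMr; apply/andP; split; last exact: xpD.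
  by apply/coprimezXr/xpD => //; apply: pm.
- apply/allP => z zc; apply/p5/xpD; first exact: xc.
  by have /and4P[] := cb z zc.
- apply/p5/p2; apply: (@coprimez_comb _ _ (- b - x) 1 (b ^+ 2 * (10 * b + 1))); first by ring.
  rewrite coprimezMr; apply/andP; split; last exact: xmD.
  by apply/coprimezXr/xmD => //; apply: mm.
- apply/allP => z zc; rewrite coprimeNz; apply/p5/xmD; first exact: xc.
  by have /and4P[] := cb z zc.
apply/allP => z zc; rewrite coprimeNz; apply/coprimezXl/xsD; first exact: xc.
by have /and4P[] := cb z zc.
Qed.

(** Modulo [f] one has b = 0 and x = 1, so the first four entries are 1 or -1. *)
Lemma tuple_any_ndvdz z f : z \in tuple_any b x c -> (3 <= f)%N -> (f %| M)%N ->
  ~~ (f %| z)%Z.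
Proof.
move=> z_in f_ge3 fM; have fb : (f %| b)%Z by apply: dvdz_trans bM.
have fx : (f %| x - 1)%Z by apply: dvdz_trans xb.
move: z_in; rewrite !inE => /predU1P[->|/or4P[/eqP->|/eqP->|/eqP->|zc]];
  last by apply: (@ndvdz_part M) => //; [exact: cM | exact: c4].
all: apply: coprimez_ndvdz => //; rewrite ?coprimeNz.
- rewrite coprimezMl; apply/andP; split; last exact/coprimezXl/coprimez_congr/c1.
  by apply: coprimez_congr (cN1 f); rewrite opprK subrK dvdz_mull.
- apply/coprimezXl/coprimez_congr/c1.
  by rewrite addrAC rpredD.
- apply/coprimezXl/coprimez_congr/c1.
  by rewrite addrAC rpredB.
apply/coprimezXl/coprimez_congr/c1.
have -> : x ^+ 2 + 10 * b ^+ 3 - 1 = (x - 1) * (x + 1) + 10 * b ^+ 3 by ring.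
by apply: rpredD; [exact: dvdz_mulr | exact/dvdz_mull/dvdz_exp].
Qed.

End TupleAny.

Lemma U_any_quality (R : realType) (n : nat) (F : set nat) :
  (6 <= n)%N -> finite_set F -> (forall f, F f -> (3 <= f)%N) ->
  infinite_set (U F n) /\ (((2 * 5)%:R / 4%:R)%:E <= Q R (U F n))%E.
Proof.
move=> n_ge6 F_fin F_ge3.
have [M M_gt0 FM] := common_multiple F F_fin F_ge3.
pose m := (n - 6)%N; have nE : n = m.+2.+4 by rewrite /m; lia.
have [b b_gt0 b_dvd] : exists2 b,
    (0 < b)%N & forall d, (d %| 10 * 3 * 11 * 101 * M)%N -> (d %| b)%N.
  by exists (10 * 3 * 11 * 101 * M)%N; rewrite // muln_gt0 M_gt0.
have bz_gt0 : 0 < b%:Z by [].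
pose K : int := 100 * b%:Z ^+ 6 - 2 * b%:Z ^+ 5.
have K_neq0 : K != 0 := tuple_any_const_neq0 b bz_gt0.
(* These factors are the bases of the first four entries at x = 1; the summands of [K] must avoid
   their primes. The product is odd since b is even. *)
pose w : int := (1 + b%:Z) * ((1 - b%:Z) * ((10 * b%:Z - 1) * (1 + 10 * b%:Z ^+ 3))).
have W_odd : odd (`|w| * (M`_(2%N)^')%N)%N.
  rewrite oddM; apply/andP; split; last by rewrite -[odd _]negbK -dvdn2 -p'natE // part_pnat.
  have b_even : ~~ odd b by rewrite -dvdn2 b_dvd // -!mulnA dvdn_mulr.
  rewrite !abszM !oddM; clear -b_even; move: (b%:Z ^+ 3) => y.
  by apply/and4P; split; lia.
have [c [[c_size c_sum c_pw c_rig] [c_W c_4 _]]] :=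
  split_sum m K _ `|K| W_odd K_neq0.
have cM : {in c, forall z : int, coprime `|z| (M`_(2%N)^')%N}.
  by move=> z /c_W; rewrite coprimeMr => /andP[].
have cb : {in c, forall z : int, [&& coprimez (1 + b%:Z) z, coprimez (1 - b%:Z) z,
    coprimez (10 * b%:Z - 1) z & coprimez (1 + 10 * b%:Z ^+ 3) z]}.
  move=> z /c_W; rewrite coprimeMr => /andP[+ _]; rewrite -coprimezE.
  by rewrite coprimez_sym !coprimezMl.
pose N := (\prod_(z <- c) `|z|)%N; pose H := (\sum_(z <- c) `|z|)%N.
have N_gt0 : (0 < N)%N.
  rewrite /N big_seq_cond prodn_cond_gt0 // => z; rewrite andbT => /c_4.
  by rewrite lt0n; apply: contra => /eqP->.
pose a := (10 * b - 1)%N; have aE : a%:Z = 10 * b%:Z - 1 by rewrite /a; clear -b_gt0; lia.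
have a_gt0 : (0 < a)%N by rewrite /a; clear -b_gt0; lia.
(* Again [P] collects all prescribed divisors, now of x - 1, and its last factor makes x large. *)
pose P := (b * (10 * b + 1) * a * N * (1000 * b ^ 6 + H))%N; pose m0 := P.+1.
pose x k := m0%:Z ^+ k.+1.
have x_ge k : P%:Z < x k.
  apply: lt_le_trans (_ : m0%:Z <= _); first by rewrite ltz_nat.
  by rewrite ler_eXnr // lez_nat.
have HE : \sum_(z <- c) `|z| = H%:Z.
  by rewrite /H (big_morph Posz PoszD (erefl _ : Posz 0 = 0)); apply: eq_bigr.
have x_large k : 1000 * b%:Z ^+ 6 + \sum_(z <- c) `|z| < x k.
  apply: le_lt_trans (x_ge k); rewrite HE -PoszX -!PoszM -PoszD lez_nat /P leq_pmull //.
  by rewrite !muln_gt0 b_gt0 a_gt0 N_gt0 addn1.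
have xP k d : (d %| P)%N -> (d %| x k - 1)%Z.
  by move=> dP; apply: dvdz_trans (dvdz_sub1_exp P k.+1).
have xb k : (b %| x k - 1)%Z by apply: xP; rewrite /P -!mulnA dvdn_mulr.
have xp k : (10 * b%:Z + 1 %| x k - 1)%Z.
  by apply: (xP k (10 * b + 1)%N); rewrite /P -!mulnA mulnCA dvdn_mulr.
have xm k : (10 * b%:Z - 1 %| x k - 1)%Z.
  by rewrite -aE; apply: xP; rewrite /P -!mulnA dvdn_mull // dvdn_mull // dvdn_mulr.
have xc k : {in c, forall z : int, (z %| x k - 1)%Z}.
  move=> z zc; rewrite dvdzE; apply: dvdn_trans (_ : N %| _)%N.
    exact: prod_dvdn_seq.
  by apply: (xP k N); rewrite /P dvdn_mulr // dvdn_mull.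
have bM : (M %| b%:Z)%Z by apply: (b_dvd M); rewrite dvdn_mull.
have b10 : (10 %| b%:Z)%Z by apply: (b_dvd 10%N); rewrite dvdn_mulr.
have b3 : (3 %| b%:Z)%Z by apply: (b_dvd 3%N); rewrite dvdn_mulr.
have b11 : (11 %| b%:Z)%Z by apply: (b_dvd 11%N); rewrite dvdn_mulr.
have b101 : (101 %| b%:Z)%Z by apply: (b_dvd 101%N); rewrite dvdn_mulr.
have t_size k : size (tuple_any b%:Z (x k) c) == n by rewrite /= c_size -nE.
have t_neq0 k : 0 \notin Tuple (t_size k) by apply: tuple_any_neq0.
have m0_gt1 : (1 < m0)%N by rewrite ltnS !(muln_gt0, addn_gt0, expn_gt0) b_gt0 a_gt0 N_gt0 ?orbT.
rewrite mulnC.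
apply: (@Q_ge_gtuple R n (U F n) (fun k => Tuple (t_size k)) 5 4 (m0 * a * N * 4) m0) => //.
- move=> k l /(congr1 (fun t => head 0 (tval t))) /= /oppr_inj /mulfI.
  rewrite -aE gt_eqF // => /(_ isT); rewrite -!exprM.
  have m0_neq1 : m0%:Z != 1 by rewrite eqz_nat gtn_eqF.
  by move/(ieexprIn (isT : 0 < m0%:Z) m0_neq1)/eqP; rewrite eqn_pmul2r // => /eqP[].
- move=> k; apply: U_gtuple.
  + exact: t_neq0.
  + exact: tuple_any_sum.
  + exact: tuple_any_rigid.
  + exact: tuple_any_coprime.
  + move=> z f zt Ff; apply: (@tuple_any_ndvdz M b%:Z (x k) c) => //; first exact: F_ge3.
    exact: FM.
- move=> k; exists ((x k + b%:Z) ^+ 5); first by rewrite !inE eqxx orbT.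
  by rewrite abszX mulnC expnM leq_exp2r // /x -PoszX -PoszD leq_addr.
move=> k; pose y := (m0 ^ k.+1)%N; have yE : y%:Z = x k by rewrite /x PoszX.
have b6_ge : b%:Z <= b%:Z ^+ 6 by rewrite ler_eXnr.
have b36 : b%:Z ^+ 3 <= b%:Z ^+ 6 by rewrite ler_weXn2l.
have x_gt : 1000 * b%:Z ^+ 6 < x k by apply: le_lt_trans (x_large k); rewrite HE lerDl.
pose d1 := `|(x k + b%:Z)%R|%N.
have d1E : d1%:Z = x k + b%:Z by rewrite /d1; clear -x_gt b6_ge; lia.
pose d2 := `|(x k - b%:Z)%R|%N.
have d2E : d2%:Z = x k - b%:Z by rewrite /d2; clear -x_gt b6_ge; lia.
pose d3 := `|(x k ^+ 2 + 10 * b%:Z ^+ 3)%R|%N.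
have d3E : d3%:Z = x k ^+ 2 + 10 * b%:Z ^+ 3.
  by rewrite /d3 gez0_abs // addr_ge0 ?sqr_ge0 // mulr_ge0 // exprn_ge0.
(* [m0] stands for x^4, and the three bases are at most 2 y, y and 2 y^2 with y = x, which accounts
   for the 4 in the constant. *)
exists (m0 * a * N * (d1 * d2 * d3))%N, (5 * k.+1)%N; split.
- rewrite !muln_gt0 a_gt0 N_gt0 /= -!ltz_nat d1E d2E d3E.
  have b3_gt0 : 0 < b%:Z ^+ 3 by rewrite exprn_gt0.
  have x2_ge0 := sqr_ge0 (x k).
  by clear -x_gt b6_ge bz_gt0 b3_gt0 x2_ge0; apply/andP; split; [apply/andP; split|]; lia.
- rewrite -(mulnA _ 4%N) leq_mul2l [(4 * k.+1)%N]mulnC expnM -/y; apply/orP; right.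
  have d1_le : (d1 <= 2 * y)%N by rewrite -lez_nat PoszM d1E yE; clear -x_gt b6_ge; lia.
  have d2_le : (d2 <= y)%N by rewrite -lez_nat d2E yE; clear -x_gt b6_ge; lia.
  have d3_le : (d3 <= 2 * y ^ 2)%N.
    rewrite -lez_nat PoszM PoszX d3E yE.
    have : x k <= x k ^+ 2 by rewrite ler_eXnr // -yE lez_nat expn_gt0.
    by clear -x_gt b36 b6_ge; lia.
  apply: leq_trans (leq_mul (leq_mul d1_le d2_le) d3_le) _.
  by apply: eq_leq; ring.
have -> : (m0 * a * N * (d1 * d2 * d3) = a * m0 * (d1 * (d2 * (d3 * N))))%N by ring.
rewrite !big_cons abszM abszN abszM (abszX 4) abszM abszX abszM abszN abszX
  abszM abszN (abszX 2) abszX_prod.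
rewrite abszX -aE -expnM.
rewrite -/d1 -/d2 -/d3 -/N !expnMn !absz_nat.
rewrite !dvdn_mul //; do ?[exact: dvdn_exp].
all: by apply: dvdn_exp2l; clear; lia.
Qed.

(** * The gcd-1 version *)

(** These are the homogeneous forms of degree [k] in x and (x - 1)^2 with all k + 1 coefficients
    positive. *)
Definition posform (k : nat) (f : int -> int) := exists e : nat -> nat,
  (forall j, (j <= k)%N -> (0 < e j)%N) /\
  forall x, f x = \sum_(j < k.+1) (e j)%:Z * x ^+ j * ((x - 1) ^+ 2) ^+ (k - j).

Lemma posformD (k : nat) (f g : int -> int) : posform k f -> posform k g ->
  posform k (fun x => f x + g x).
Proof.
move=> [e [e_gt0 fE]] [d [d_gt0 gE]]; exists (fun j => e j + d j)%N; split.
  by move=> j jk; rewrite addn_gt0 e_gt0.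
by move=> x; rewrite fE gE -big_split; apply: eq_bigr => j _; rewrite PoszD !mulrDl.
Qed.

(** Multiplication by x shifts the coefficients of [f] by one. The first coefficient of the result
    comes from [g] and the last from [f], so all are positive. *)
Lemma posformS (k : nat) (f g : int -> int) : posform k f -> posform k g ->
  posform k.+1 (fun x => x * f x + (x - 1) ^+ 2 * g x).
Proof.
move=> [d [d_gt0 fE]] [e [e_gt0 gE]].
exists (fun j => (if j is j'.+1 then d j' else 0) + (if j <= k then e j else 0))%N; split.
  by case=> [|j] jk; rewrite addn_gt0 ?e_gt0 // d_gt0.
move=> x; rewrite fE gE; set w := (x - 1) ^+ 2.
under [RHS]eq_bigr do rewrite PoszD !mulrDl.
have z0 : Posz 0 = 0 by [].
rewrite big_split /=; congr (_ + _).
  rewrite [RHS]big_ord_recl /= z0 !mul0r add0r mulr_sumr; apply: eq_bigr => j _.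
  by rewrite subSS exprS; ring.
rewrite [RHS]big_ord_recr /= ltnn z0 !mul0r addr0 mulr_sumr; apply: eq_bigr => j _ /=.
have jk : (j <= k)%N by rewrite -ltnS ltn_ord.
by rewrite jk subSn // exprS; ring.
Qed.

(* The companion [g] makes the recursion free of subtractions. *)
Lemma posform_exp_sub1 (k : nat) : exists f g : int -> int,
  [/\ posform k f, posform k g &
   forall x, x ^+ (2 * k).+1 - 1 = (x - 1) * f x /\ x ^+ (2 * k) + 1 = g x].
Proof.
elim: k => [|k [f [g [f_pos g_pos fgE]]]].
  exists (fun=> 1), (fun=> 2); split.
  - by exists (fun=> 1%N); split=> // x; rewrite big_ord1 !mulr1.
  - by exists (fun=> 2%N); split=> // x; rewrite big_ord1 !mulr1.
  - by move=> x; rewrite muln0 mulr1 expr0 expr1.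
(* This comes from x^(2k+2) + 1 = x (x^(2k) + 1) + (x - 1)(x^(2k+1) - 1) and x^(2k+3) - 1 = x
   (x^(2k+1) - 1) + (x - 1)(x^(2k+2) + 1), the latter divided by x - 1. *)
exists (fun x => x * (f x + g x) + (x - 1) ^+ 2 * f x).
exists (fun x => x * g x + (x - 1) ^+ 2 * f x); split.
- exact: posformS (posformD k f g f_pos g_pos) f_pos.
- exact: posformS.
move=> x; have [fE gE] := fgE x; rewrite mulnS addSn addSn add0n.
have -> : (x - 1) ^+ 2 * f x = (x - 1) * (x ^+ (2 * k).+1 - 1) by rewrite fE; ring.
split; last by rewrite -gE !exprS; ring.
rewrite -gE; transitivity ((x - 1) * f x * x +
    (x - 1) * (x * (x ^+ (2 * k) + 1) + (x - 1) * (x ^+ (2 * k).+1 - 1))).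
  by rewrite -fE !exprS; ring.
by ring.
Qed.

Lemma exp_sub1_decomp (k : nat) : exists e : nat -> nat,
  (forall j, (j <= k)%N -> (0 < e j)%N) /\
  forall x : int, x ^+ (2 * k).+1 - 1 =
    \sum_(j < k.+1) (e j)%:Z * x ^+ j * (x - 1) ^+ (2 * (k - j)).+1.
Proof.
have [f [g [[e [e_gt0 fE]] _ fgE]]] := posform_exp_sub1 k.
exists e; split=> // x; rewrite (fgE x).1 fE mulr_sumr; apply: eq_bigr => j _.
by rewrite [in RHS]exprS exprM; ring.
Qed.

Lemma pos_subsum (s T : nat -> int) (K : nat) (Y : int) :
  (forall i, s i \in [:: 0; 1]) -> (forall j, (j < K)%N -> 0 < T j) ->
  Y = 1 + \sum_(j < K) T j ->
  s 0%N * Y = s 1%N + \sum_(j < K) s j.+2 * T j ->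
  forall i, (i < K.+2)%N -> s i = s 0%N.
Proof.
move=> s01 T_gt0 -> sE.
have s01' i : s i = 0 \/ s i = 1 by have := s01 i; rewrite !inE => /orP[]/eqP->; [left|right].
(* [d i] is 1 if [s i] differs from [s 0] and 0 otherwise. A sum of these with positive weights
   vanishes, for both values of [s 0] at once. *)
pose d i := (1 - 2 * s 0%N) * (s i - s 0%N).
have d_ge0 i : 0 <= d i.
  by rewrite /d; case: (s01' 0%N) => ->; case: (s01' i) => ->.
have d_sum : d 1%N + \sum_(j < K) d j.+2 * T j = 0.
  have -> : \sum_(j < K) d j.+2 * T j =
      (1 - 2 * s 0%N) * (\sum_(j < K) s j.+2 * T j - s 0%N * \sum_(j < K) T j).
    rewrite mulr_sumr -sumrB mulr_sumr; apply: eq_bigr => j _.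
    by rewrite /d; ring.
  transitivity ((1 - 2 * s 0%N) * ((s 1%N + \sum_(j < K) s j.+2 * T j) -
      s 0%N * (1 + \sum_(j < K) T j))); first by rewrite /d; ring.
  by rewrite sE subrr mulr0.
have dT_ge0 (j : 'I_K) : 0 <= d j.+2 * T j by rewrite mulr_ge0 // ltW // T_gt0.
have d0 i : d i = 0 -> s i = s 0%N.
  by rewrite /d; case: (s01' 0%N) => ->; case: (s01' i) => ->.
move/eqP: d_sum; rewrite paddr_eq0 ?sumr_ge0 // => /andP[/eqP d1 /eqP dT].
case=> [|[|j]] // jK; apply: d0 => //.
have /eqP := @psumr_eq0P _ _ predT _ (fun j _ => dT_ge0 j) dT (Ordinal (jK : (j < K)%N)) isT.
by rewrite mulf_eq0 (gt_eqF (T_gt0 j jK)) orbF => /eqP.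
Qed.

Lemma prod_dvdn_exp (s : seq int) (d e : nat) :
  {in s, forall z : int, (`|z| %| d ^ e)%N} ->
  (`|(\prod_(z <- s) z)%R| %| d ^ (e * size s))%N.
Proof.
elim: s => [|z s IHs] dvd_s; first by rewrite big_nil dvd1n.
rewrite big_cons abszM /= mulnS expnD dvdn_mul ?dvd_s ?mem_head //.
by apply: IHs => y ys; rewrite dvd_s // inE ys orbT.
Qed.

Lemma A_quality (R : realType) (n : nat) : (3 <= n)%N ->
  infinite_set (A n) /\ (((2 * (2 * n - 5))%:R / 1%:R)%:E <= Q R (A n))%E.
Proof.
move=> n_ge3; pose k := (n - 3)%N; have nE : n = k.+3 by rewrite /k; lia.
have -> : (2 * n - 5 = (2 * k).+1)%N by rewrite nE; lia.
have [e [e_gt0 eE]] := exp_sub1_decomp k.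
pose T x j := (e j)%:Z * x ^+ j * (x - 1) ^+ (2 * (k - j)).+1.
pose s x := [:: x ^+ (2 * k).+1, -1 & mkseq (fun j => - T x j) k.+1].
have sE (b : nat -> int) y : \sum_(i < size (s y)) b i * (s y)`_i =
    b 0%N * y ^+ (2 * k).+1 - (b 1%N + \sum_(j < k.+1) b j.+2 * T y j).
  pose c := mkseq (fun j => - T y j) k.+1.
  rewrite (sum_nth_cons b _ (-1 :: c)) (sum_nth_cons (fun i => b i.+1) _ c) size_mkseq.
  rewrite mulrN1 opprD -sumrN; congr (_ + (_ + _)).
  by apply: eq_bigr => j _; rewrite nth_mkseq // mulrN.
(* The exponent l + 1 keeps x - 1 positive also for l = 0. *)
pose x l := 2%:Z ^+ l.+1.
have t_size l : size (s (x l)) == n by rewrite nE /= size_map size_iota.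
have x_ge2 l : 2 <= x l by rewrite /x ler_eXnr.
have x_gt0 l : 0 < x l by rewrite exprn_gt0.
have x1_gt0 l : 0 < x l - 1 by have := x_ge2 l; clear; lia.
have T_gt0 l j : (j < k.+1)%N -> 0 < T (x l) j.
  by move=> jk; rewrite !mulr_gt0 ?exprn_gt0 // ltz_nat e_gt0.
have in_s z l : z \in s (x l) -> [\/ z = x l ^+ (2 * k).+1, z = -1 |
    exists2 j, (j < k.+1)%N & z = - T (x l) j].
  rewrite in_cons => /predU1P[->|]; first by constructor 1.
  rewrite in_cons => /predU1P[->|/seq.mapP[j]]; first by constructor 2.
  by rewrite mem_iota => jk ->; constructor 3; exists j.
have t_neq0 l : 0 \notin Tuple (t_size l).
  apply/negP => /in_s[/eqP|//|[j /(T_gt0 l) T_gt0' /eqP]].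
    by rewrite eq_sym expf_eq0 gt_eqF.
  by rewrite eq_sym oppr_eq0 gt_eqF.
pose E := (\prod_(j < k.+1) e j)%N.
have E_gt0 : (0 < E)%N by apply: prodn_gt0 => j; rewrite e_gt0 // -ltnS.
apply: (@Q_ge_gtuple R n (A n) (fun l => Tuple (t_size l)) (2 * k).+1 1 (2 * E) 2) => //.
- move=> l l' /(congr1 (fun t => head 0 (tval t))) /=; rewrite -!exprM.
  by move/(ieexprIn (isT : 0 < 2%:Z) isT)/eqP; rewrite eqn_pmul2r // => /eqP[].
- move=> l; apply: A_gtuple.
  + exact: t_neq0.
  + rewrite 2!big_cons big_map -[iota 0 k.+1]/(index_iota 0 k.+1) big_mkord sumrN -eE.
    by ring.
  + by rewrite !inE eqxx orbT.
  move=> b bB b0 i; rewrite size_tuple nE => i_lt.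
  apply: (@pos_subsum b (T (x l)) k.+1 (x l ^+ (2 * k).+1)) => //; first exact: T_gt0.
    by rewrite -eE; ring.
  by apply/eqP; rewrite -subr_eq0 -sE; apply/eqP.
- move=> l; exists (x l ^+ (2 * k).+1); first exact: mem_head.
  by rewrite abszX /x abszX -expnM mulnC.
move=> l; pose y := `|(x l - 1)%R|%N; have yE : y%:Z = x l - 1 by rewrite gez0_abs // ltW.
pose N := (l.+1 * (2 * k).+1)%N.
(* The prime 2 accounts for the powers of x, [E] for the fixed coefficients and [y] for the powers
   of x - 1. The exponent [N] suffices for each entry and is multiplied by their number. *)
exists (2 * E * y)%N, (N * size (s (x l)))%N; split.
- by rewrite !muln_gt0 E_gt0 /= -ltz_nat yE.
- rewrite leq_mul2l mul1n -lez_nat yE PoszX; apply/orP; right.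
  by clear; rewrite /x; lia.
apply: prod_dvdn_exp => z.
rewrite !expnMn => /in_s[->|->|[j jk ->]].
- by rewrite abszX /x abszX -expnM -mulnA dvdn_mulr.
- by rewrite dvd1n.
rewrite abszN !abszM (abszX j) (abszX (2 * _).+1) -/y; apply: dvdn_mul.
  rewrite mulnC; apply: dvdn_mul.
    by rewrite /x abszX -expnM dvdn_exp2l // leq_mul2l; clear -jk; lia.
  apply: dvdn_exp; first by rewrite muln_gt0.
  by rewrite /E (bigD1 (Ordinal jk)) //= dvdn_mulr.
by apply: dvdn_exp2l; rewrite /N; apply: leq_trans (leq_pmull _ _) => //; clear; lia.
Qed.

Theorem theorem3p5 (R : realType) :
  [/\ forall (n : nat) (F : set nat),
        odd n -> (5 <= n)%N ->
        finite_set F -> (forall f, F f -> (3 <= f)%N) ->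
        (forall f, F f -> ~~ [|| (f %| 2)%N, (f %| 5)%N | (f %| 10)%N]) ->
        infinite_set (U F n) /\ ((10 / 3)%:E <= Q R (U F n))%E,
      forall (n : nat) (F : set nat),
        (6 <= n)%N ->
        finite_set F -> (forall f, F f -> (3 <= f)%N) ->
        infinite_set (U F n) /\ ((5 / 2)%:E <= Q R (U F n))%E
    & forall n : nat, (3 <= n)%N ->
        infinite_set (A n) /\ ((4 * n%:R - 10)%:E <= Q R (A n))%E].
Proof.
split=> [n F n_odd n_ge5 F_fin F_ge3 F10|n F n_ge6 F_fin F_ge3|n n_ge3].
- by apply: U_odd_quality => // f /F10; rewrite !negb_or => /and3P[].
- have -> : 5 / 2 = (2 * 5)%:R / 4%:R :> R by rewrite natrM; field.
  exact: U_any_quality.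
have -> : 4 * n%:R - 10 = (2 * (2 * n - 5))%:R / 1%:R :> R.
  by rewrite divr1 natrM natrB ?natrM; [ring | lia].
exact: A_quality.
Qed.
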